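(* For every $\varepsilon>0$ there is an $n_0=n_0(\varepsilon)$ such that for every $n\ge n_0$ and $m=n(1-\varepsilon)$, every $m\times n$ latin rectangle $\mathsf{J}$ on $n$ symbols has an orthogonal companion, i.e. there exists an $m\times n$ latin rectangle $\mathsf{L}$ on the same $n$ symbols such that $\mathsf{L}$ and $\mathsf{J}$ are orthogonal.
   Context: An $m\times n$ latin rectangle on a set $\mathcal{S}$ of $n$ symbols is an assignment of a symbol from $\mathcal{S}$ to each cell of an $m\times n$ array ($m$ rows, $n$ columns) such that each symbol occurs exactly once in each row and at most once in each column. Two $m\times n$ latin rectangles $\mathsf{L},\mathsf{J}$ on the same symbol set are orthogonal if for any two symbols $\alpha,\beta$ the set of cells receiving $\alpha$ in $\mathsf{L}$ and the set of cells receiving $\beta$ in $\mathsf{J}$ intersect in at most one cell; equivalently, the $mn$ pairs $(\mathsf{L}(i,j),\mathsf{J}(i,j))$ are pairwise distinct. *)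

(* Defs.v *)
From mathcomp Require Import all_boot.

Set Implicit Arguments.
Unset Strict Implicit.
Unset Printing Implicit Defensive.

(* L i j is the symbol in row i and column j.  That S has exactly n symbols
   is not part of this predicate: the row condition forces it when 0 < m, and
   for m = 0 it has to be assumed separately. *)
Definition latin_rectangle (m n : nat) (S : finType)
    (L : 'I_m -> 'I_n -> S) : Prop :=
  (forall (i : 'I_m) (s : S), #|[set j : 'I_n | L i j == s]| = 1) /\
  (forall (j : 'I_n) (s : S), #|[set i : 'I_m | L i j == s]| <= 1).

Definition symbol_cells (m n : nat) (S : finType)
    (L : 'I_m -> 'I_n -> S) (s : S) : {set 'I_m * 'I_n} :=
  [set c | L c.1 c.2 == s].

Definition orthogonal_rectangles (m n : nat) (S : finType)
    (L J : 'I_m -> 'I_n -> S) : Prop :=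
  forall a b : S, #|symbol_cells L a :&: symbol_cells J b| <= 1.

(* Main.v *)
Require Import Defs.
From mathcomp Require Import all_boot all_order all_fingroup all_algebra.
From mathcomp Require Import reals sequences exp.
From mathcomp Require Import ring lra zify.

(** View L as a colouring of the cells of J.  Every colour has to be used
    exactly once in each row, and at most once on each column and on each symbol
    of J.  The rows are coloured one at a time in random order: a uniformly
    random uncoloured row i receives a random perfect matching between its cells
    and the colours, inside the graph of the pairs (cell, colour) such that the
    colour is still unused both on the column and on the symbol of the cell.

    After t rows, with n - t colours left at every column and symbol and m - t
    rows left, the degrees of that graph stay close to (n - t)^2 / n, and the
    number of remaining rows in which a colour unused at a column is also unused
    at the symbol met there stays close to (m - t)(n - t) / n.  Choosing the row
    at random makes the drift of these degrees a function of the degrees alone.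
    The common degrees of pairs of cells stay close to (n - t)^4 / n^3; their
    being linear in n is what makes it possible to correct the uniform edge
    weights into a doubly stochastic matrix with nearly constant entries, from
    which the matching is drawn by Birkhoff's theorem.  All tracked quantities
    change by at most 4 per step, so an exponential potential controls them; as
    its expectation does not increase, some choice at each step keeps it below 1.

    The relative errors cannot be controlled once too few rows are left, but a
    final segment of alpha n rows changes the degrees by at most 4 alpha n, and
    there arbitrary perfect matchings will do. *)

Set Implicit Arguments.
Unset Strict Implicit.
Unset Printing Implicit Defensive.

Import Order.TTheory GRing.Theory Num.Theory.

(** * Perfect matchings *)

(* Rado's proof: if some A j has two elements, one of them can be deleted from
   A j without violating Hall's condition. *)
Lemma hall_marriage (T U : finType) (A : T -> {set U}) :
  (forall S : {set T}, #|S| <= #|\bigcup_(i in S) A i|) ->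
  exists2 f : T -> U, injective f & forall i, f i \in A i.
Proof.
have [w] := ubnP (\sum_i #|A i|); elim: w A => // w IHw A wA hA.
have A_gt0 i : 0 < #|A i| by have := hA [set i]; rewrite cards1 big_set1.
have [j /card_gt1P[k1 [k2 [k1j k2j k12]]]|A_le1] :=
    pickP (fun i => 1 < #|A i|); last first.
  have A1 i : exists k, A i == [set k].
    have /cards1P[k ->] : #|A i| == 1.
      by rewrite eqn_leq A_gt0 andbT leqNgt; apply/negbT; apply: A_le1.
    by exists k.
  exists (fun i => xchoose (A1 i)) => [i i' eqf|i]; last first.
    by have /eqP {2}-> := xchooseP (A1 i); rewrite set11.
  apply/eqP/negPn/negP => ii'; have := hA [set i; i'].
  rewrite cards2 ii' bigcup_setU !big_set1.
  by rewrite (eqP (xchooseP (A1 i))) (eqP (xchooseP (A1 i'))) eqf setUid cards1.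
pose B k i := if i == j then A j :\ k else A i.
have B_lt k : k \in A j -> \sum_i #|B k i| < w.
  move=> kj; rewrite -ltnS; apply: leq_trans wA; rewrite ltnS.
  rewrite (bigD1 j) //= [ltnRHS](bigD1 j) //= /B eqxx.
  rewrite -addSn leq_add //.
    by rewrite (cardsD1 k (A j)) kj add1n.
  by apply: leq_sum => i /negPf ->.
have B_sub k i : B k i \subset A i.
  by rewrite /B; case: eqP => [->|//]; apply: subsetDl.
have B_case k : k \in A j ->
    (exists2 f : T -> U, injective f & forall i, f i \in A i) \/
    exists2 S : {set T}, j \notin S &
      #|\bigcup_(i in S) A i :|: A j :\ k| <= #|S|.
  move=> kj.
  have [/forallP hB|] := boolP [forall S : {set T},
      #|S| <= #|\bigcup_(i in S) B k i|].
    have [f fI fB] := IHw (B k) (B_lt _ kj) hB.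
    by left; exists f => // i; apply: (subsetP (B_sub k i)).
  rewrite negb_forall => /existsP[S]; rewrite -ltnNge => ltS; right.
  have jS : j \in S.
    apply/negPn/negP => jS; move: ltS; rewrite ltnNge => /negP[].
    rewrite (eq_bigr A) ?hA // => i iS; rewrite /B.
    by case: eqP iS jS => // -> ->.
  exists (S :\ j); first by rewrite setD11.
  move: ltS; rewrite (cardsD1 j S) jS add1n ltnS; apply: leq_trans.
  apply: subset_leq_card; rewrite subUset; apply/andP; split.
    apply/bigcupsP => i /setD1P[ij iS]; apply: (bigcup_max i) => //.
    by rewrite /B (negPf ij).
  by apply: (bigcup_max j) => //; rewrite /B eqxx.
case: (B_case _ k1j) => // -[S1 jS1 hS1].
case: (B_case _ k2j) => // -[S2 jS2 hS2].
(* Of [A j], [U1] can miss only [k1] and [U2] only [k2], so their union covers all neighbours of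
   [j |: (S1 :|: S2)]; their intersection covers those of [S1 :&: S2]. Hall's condition for both
   gives #|U1| + #|U2| > #|S1| + #|S2|, a contradiction. *)
set U1 : {set U} := _ :|: _ in hS1; set U2 : {set U} := _ :|: _ in hS2.
have leU : #|j |: (S1 :|: S2)| <= #|U1 :|: U2|.
  apply: leq_trans (hA _) (subset_leq_card _).
  apply/bigcupsP => i /setU1P[->|/setUP[iS|iS]].
  - apply/subsetP => k kj; rewrite !inE kj !andbT.
    by case: (eqVneq k k1) => [->|]; rewrite ?k12 ?orbT.
  - by apply/subsetP => k ki; do 2!(apply/setUP; left); apply/bigcupP; exists i.
  - by apply/subsetP => k ki; apply/setUP; right; apply/setUP; left;
      apply/bigcupP; exists i.
have leI : #|S1 :&: S2| <= #|U1 :&: U2|.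
  apply: leq_trans (hA _) (subset_leq_card _).
  apply/bigcupsP => i /setIP[i1 i2]; apply/subsetP => k ki.
  by apply/setIP; split; apply/setUP; left; apply/bigcupP; exists i.
move: leU; rewrite cardsU1 inE negb_or jS1 jS2 /= => leU.
have := cardsUI S1 S2; have := cardsUI U1 U2; lia.
Qed.

Local Open Scope ring_scope.

(** Hall's condition by weighing: the rows of [S] carry weight r #|S|, all of it in the columns
    where they have positive entries, and each column carries only r. *)
Lemma stochastic_perm (R : realFieldType) (T : finType) (r : R)
    (p : T -> T -> R) : 0 < r -> (forall j k, 0 <= p j k) ->
  (forall j, \sum_k p j k = r) -> (forall k, \sum_j p j k = r) ->
  exists s : {perm T}, forall j, 0 < p j (s j).
Proof.
move=> r_gt0 p_ge0 sum_row sum_col.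
pose A j := [set k | 0 < p j k].
have [|f fI fA] := @hall_marriage T T A.
  move=> S; set N := \bigcup_(_ in _) _.
  rewrite -(ler_nat R) -(ler_pM2r r_gt0) !mulr_natl.
  rewrite -(sumr_const (mem S)) -(sumr_const (mem N)) /=.
  rewrite (eq_bigr (fun j => \sum_(k in N) p j k)); last first.
    move=> j jS; rewrite -(sum_row j) [LHS](bigID (mem N)) /=.
    rewrite [X in _ + X]big1 ?addr0 // => k; apply: contraNeq => pjk.
    by apply/bigcupP; exists j => //; rewrite inE lt0r pjk p_ge0.
  rewrite exchange_big /=; apply: ler_sum => k _; rewrite -(sum_col k).
  rewrite [leRHS](bigID (mem S)) /= lerDl.
  by apply: sumr_ge0.
by exists (perm fI) => j; have := fA j; rewrite inE permE.
Qed.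

(** Subtracting the smallest entry along a permutation inside the support makes one more entry
    vanish and keeps all line sums equal. The free line sum [r] serves this induction on the size of
    the support. *)
Lemma birkhoff (R : realFieldType) (T : finType) (r : R) (p : T -> T -> R) :
  0 <= r -> (forall j k, 0 <= p j k) ->
  (forall j, \sum_k p j k = r) -> (forall k, \sum_j p j k = r) ->
  exists c : {perm T} -> R, [/\ forall s, 0 <= c s,
    forall s j, 0 < c s -> 0 < p j (s j) &
    forall j k, \sum_s c s * (s j == k)%:R = p j k].
Proof.
have [w] := ubnP #|[set x : T * T | p x.1 x.2 != 0]|.
elim: w r p => // w IHw r p wp r_ge0 p_ge0 sum_row sum_col.
have [r0|r_neq0] := eqVneq r 0.
  have p0 j k : p j k = 0.
    apply/eqP; move: (sum_row j); rewrite r0 => /eqP.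
    by rewrite psumr_eq0 => [/allP/(_ k (mem_index_enum k))|].
  exists (fun => 0); split=> // [s j|j k]; first by rewrite ltxx.
  by rewrite big1 ?p0 // => s _; rewrite mul0r.
have r_gt0 : 0 < r by rewrite lt0r r_neq0.
have [s0 s0p] := stochastic_perm r_gt0 p_ge0 sum_row sum_col.
have [j0 _|T0] := pickP (fun _ : T => true); last first.
  exists (fun => 0); split=> // [s j|j k]; last by have := T0 j.
  by rewrite ltxx.
have [j1 _ j1_min] := @arg_minP _ _ _ j0 xpredT (fun j => p j (s0 j)) isT.
set q := p j1 (s0 j1) in j1_min; have q_gt0 : 0 < q by apply: s0p.
pose p' j k := p j k - q * (s0 j == k)%:R.
have [||||//|c [c_ge0 c_sub c_sum]] := IHw (r - q) p'.
- rewrite -ltnS; apply: leq_trans wp; rewrite ltnS; apply: proper_card.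
  apply/properP; split.
    apply/subsetP => -[j k]; rewrite !inE /= /p'; apply: contraNneq => pjk.
    have [eqk|_] := eqVneq (s0 j) k; last by rewrite mulr0 subr0 pjk.
    by have := s0p j; rewrite eqk pjk ltxx.
  exists (j1, s0 j1); rewrite !inE /=; first by rewrite gt_eqF.
  by rewrite /p' eqxx mulr1 subrr eqxx.
- rewrite subr_ge0 -(sum_row j1) (bigD1 (s0 j1)) //= lerDl.
  by apply: sumr_ge0.
- move=> j k; rewrite /p'; case: eqP => [<-|_]; last by rewrite mulr0 subr0.
  by rewrite mulr1 subr_ge0 j1_min.
- move=> j; rewrite /p' sumrB sum_row (bigD1 (s0 j)) //= eqxx mulr1.
  by rewrite big1 ?addr0 // => k /negPf; rewrite eq_sym => ->; rewrite mulr0.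
- move=> k; rewrite /p' sumrB sum_col (bigD1 ((s0^-1)%g k)) //= permKV eqxx mulr1.
  rewrite big1 ?addr0 // => j.
  have [<-|_ _] := eqVneq (s0 j) k; last by rewrite mulr0.
  by rewrite permK eqxx.
exists (fun s => c s + q * (s == s0)%:R); split.
- by move=> s; rewrite addr_ge0 // mulr_ge0 ?ler0n ?ltW.
- move=> s j; have [->//|ss0] := eqVneq s s0.
  rewrite mulr0 addr0 => /(c_sub s j); rewrite /p' => /lt_le_trans; apply.
  by rewrite gerBl mulr_ge0 ?ler0n ?ltW.
- move=> j k; under eq_bigr do rewrite mulrDl.
  rewrite big_split /= c_sum (bigD1 s0) //= eqxx mulr1 big1 ?addr0.
    by rewrite /p' subrK.
  by move=> s /negPf ->; rewrite mulr0 mul0r.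
Qed.

(* The weights are 1/d plus two corrections: q1 repairs the sums over j by
   spreading each defect b k evenly over the neighbours of k, and q2 then
   repairs the sums over k by moving (a' j - a' j')/n from j' to j along the
   paths j - k - j', evenly over the common neighbours k. *)
Lemma balanced_weights (R : realFieldType) (T : finType) (G : T -> T -> bool)
    (d kap eta : R) (n := #|T|%:R : R) :
  0 < kap -> 0 < d <= n -> 0 <= eta -> (2 + 8 / kap) * eta <= 1 ->
  (forall j, `|\sum_k (G j k)%:R - d| <= eta * d) ->
  (forall k, `|\sum_j (G j k)%:R - d| <= eta * d) ->
  (forall j j', kap * n <= \sum_k (G j k && G j' k)%:R) ->
  exists p : T -> T -> R, [/\ forall j k, 0 <= p j k,
    forall j, \sum_k p j k = 1, forall k, \sum_j p j k = 1,
    forall j k, ~~ G j k -> p j k = 0 &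
    forall j k, G j k -> `|p j k - d^-1| <= (2 + 8 / kap) * eta / d].
Proof.
move=> kap_gt0 /andP[d_gt0 d_le_n] eta_ge0 eta_le1 degr degc codeg.
have n_gt0 : 0 < n by apply: lt_le_trans d_le_n.
have kn_gt0 : 0 < kap * n by apply: mulr_gt0.
have eta_half : eta <= 1 / 2.
  have : 0 <= 8 / kap * eta by rewrite !mulr_ge0 ?invr_ge0 // ltW.
  by rewrite mulrDl in eta_le1; lra.
pose r j := \sum_k (G j k)%:R : R; pose c k := \sum_j (G j k)%:R : R.
pose w j j' := \sum_k (G j k && G j' k)%:R : R.
have w_gt0 j j' : 0 < w j j' by apply: lt_le_trans (codeg j j').
have wC j j' : w j j' = w j' j by apply: eq_bigr => k _; rewrite andbC.
have c_gt k : d / 2 <= c k.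
  have := degc k; rewrite -/(c k) ler_distl => /andP[+ _]; apply: le_trans.
  by have : eta * d <= 1 / 2 * d; [rewrite ler_pM2r|lra].
have c_gt0 k : 0 < c k by apply: lt_le_trans (c_gt k); rewrite divr_gt0.
pose b k := 1 - c k / d; pose a j := 1 - r j / d.
have abs1 x : `|x - d| <= eta * d -> `|1 - x / d| <= eta.
  move=> hx; rewrite -[1](divff (lt0r_neq0 d_gt0)) -mulrBl normrM normfV.
  by rewrite (gtr0_norm d_gt0) ler_pdivrMr // distrC.
have b_le k : `|b k| <= eta by apply/abs1/degc.
have a_le j : `|a j| <= eta by apply/abs1/degr.
pose q1 j k := (G j k)%:R * (b k / c k).
have q1_le j k : `|q1 j k| <= 2 * eta / d.
  rewrite /q1 normrM normr_nat normrM normfV (gtr0_norm (c_gt0 k)).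
  have h : `|b k| / c k <= 2 * eta / d.
    rewrite ler_pdivrMr // (le_trans (b_le k)) //.
    have {1}-> : eta = 2 * eta / d * (d / 2) by field; rewrite gt_eqF.
    by rewrite ler_wpM2l // divr_ge0 ?mulr_ge0 // ltW.
  case: (G j k); rewrite ?mul1r // mul0r.
  by rewrite divr_ge0 ?mulr_ge0 // ltW.
pose a' j := a j - \sum_k q1 j k.
(* At most 3 d / 2 neighbours, each with a correction of at most 2 eta / d, shift a row sum by at
   most 3 eta. *)
have a'_le j : `|a' j| <= 4 * eta.
  have : `|\sum_k q1 j k| <= 3 * eta.
    apply: le_trans (ler_norm_sum _ _ _) _.
    apply: (@le_trans _ _ (\sum_k (G j k)%:R * (2 * eta / d))).
      apply: ler_sum => k _; have := q1_le j k; rewrite /q1.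
      by case: (G j k); rewrite ?mul1r // !mul0r normr0.
    rewrite -mulr_suml -/(r j).
    have := degr j; rewrite -/(r j) ler_distl => /andP[_ hr].
    have -> : r j * (2 * eta / d) = (r j / d) * (2 * eta) by field; rewrite gt_eqF.
    have : r j / d <= 3 / 2.
      rewrite ler_pdivrMr //.
      by have : eta * d <= 1 / 2 * d; [rewrite ler_pM2r|lra].
    by move=> h; have := ler_wpM2r (mulr_ge0 (ler0n R 2) eta_ge0) h; lra.
  have := a_le j; rewrite /a'; move: (\sum_k _) => x ha hx.
  by have := ler_normB (a j) x; lra.
have sum_q1 k : \sum_j q1 j k = b k.
  by rewrite /q1 -mulr_suml -/(c k) mulrC divfK // gt_eqF.
(* The defects [a] and the defects [b] both sum to n minus the number of edges divided by [d]. *)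
have sum_a' : \sum_j a' j = 0.
  rewrite /a' sumrB [X in _ - X]exchange_big /=.
  under [X in _ - X]eq_bigr do rewrite sum_q1.
  rewrite /a /b !sumrB -!mulr_suml /r /c.
  by rewrite [X in _ - X / d - _]exchange_big /= subrr.
pose q2 j k :=
  (G j k)%:R * \sum_j' (G j' k)%:R * ((a' j - a' j') / (n * w j j')).
have q2_le j k : `|q2 j k| <= 8 * eta / kap / n.
  have bnd : 0 <= 8 * eta / kap / n.
    by rewrite !mulr_ge0 ?invr_ge0 // ltW.
  rewrite /q2; case: (G j k); rewrite ?mul0r ?normr0 // mul1r.
  apply: le_trans (ler_norm_sum _ _ _) _.
  apply: (@le_trans _ _ (\sum_(j' : T) 8 * eta / (n * (kap * n)))).
    apply: ler_sum => j' _.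
    have h : `|(a' j - a' j') / (n * w j j')| <= 8 * eta / (n * (kap * n)).
      have nw : 0 < n * w j j' by rewrite mulr_gt0.
      rewrite normrM normfV (gtr0_norm nw) ler_pM ?invr_ge0 ?(ltW nw) //.
        have := ler_normB (a' j) (a' j').
        by have := a'_le j; have := a'_le j'; lra.
      by rewrite lef_pV2 ?posrE ?mulr_gt0 // ler_pM2l //; apply: codeg.
    case: (G j' k); rewrite ?mul1r // mul0r normr0.
    by rewrite !mulr_ge0 ?invr_ge0 ?mulr_ge0 // ltW.
  rewrite sumr_const -[_ *+ _]mulr_natr -/n le_eqVlt; apply/orP; left.
  by apply/eqP; field; rewrite !gt_eqF.
have sum_q2r j : \sum_k q2 j k = a' j.
  transitivity (\sum_j' (a' j - a' j') / n); last first.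
    rewrite -mulr_suml sumrB sum_a' subr0 sumr_const -[_ *+ _]mulr_natr -/n.
    by rewrite mulfK // gt_eqF.
  rewrite /q2; under eq_bigr do rewrite mulr_sumr.
  rewrite exchange_big /=; apply: eq_bigr => j' _.
  under eq_bigr do rewrite mulrA -natrM mulnb.
  rewrite -mulr_suml -/(w j j'); field.
  by rewrite !gt_eqF.
have sum_q2c k : \sum_j q2 j k = 0.
  pose S := \sum_j \sum_j' (G j k)%:R * ((G j' k)%:R * ((a' j - a' j') / (n * w j j'))).
  have -> : \sum_j q2 j k = S by apply: eq_bigr => j _; apply: mulr_sumr.
  (* Exchanging [j] and [j'] changes the sign of each summand. *)
  have SN : S = - S.
    rewrite {1}/S exchange_big /= /S -sumrN; apply: eq_bigr => j _.
    rewrite -sumrN; apply: eq_bigr => j' _; rewrite wC; ring.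
  by lra.
pose p j k := (G j k)%:R / d + q1 j k + q2 j k.
have p_le j k : G j k -> `|p j k - d^-1| <= (2 + 8 / kap) * eta / d.
  move=> Gjk; rewrite /p Gjk mul1r.
  have -> : d^-1 + q1 j k + q2 j k - d^-1 = q1 j k + q2 j k by ring.
  apply: le_trans (ler_normD _ _) _.
  have h2 : 8 * eta / kap / n <= 8 * eta / kap / d.
    rewrite ler_wpM2l ?lef_pV2 ?posrE //.
    by rewrite !mulr_ge0 ?invr_ge0 // ltW.
  have := q1_le j k; have := q2_le j k.
  have -> : (2 + 8 / kap) * eta / d = 2 * eta / d + 8 * eta / kap / d.
    by field; rewrite !gt_eqF.
  by lra.
exists p; split=> //.
- move=> j k; have [Gjk|nGjk] := boolP (G j k).
    have := p_le j k Gjk; rewrite ler_distl => /andP[+ _]; apply: le_trans.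
    rewrite subr_ge0 ler_pdivrMr // mulVf ?gt_eqF //.
  by rewrite /p /q1 /q2 (negPf nGjk) !mul0r !addr0.
- move=> j; rewrite /p !big_split /= sum_q2r /a' /a -mulr_suml -/(r j).
  by ring.
- move=> k; rewrite /p !big_split /= sum_q2c sum_q1 /b -mulr_suml -/(c k).
  by rewrite addr0; ring.
- by move=> j k nG; rewrite /p /q1 /q2 (negPf nG) !mul0r !addr0.
Qed.

(** * One step of the colouring process *)

(* The objects o with live o are being counted; the random event w destroys o
   if h1 w o or h2 w o holds. *)
Section Kills.
Variables (R : realFieldType) (O W : finType) (mu : W -> R).
Variables (live : O -> bool) (h1 h2 : W -> O -> bool).
Let Z : R := \sum_o (live o)%:R.
Let Z' w : R := \sum_o (live o && ~~ h1 w o && ~~ h2 w o)%:R.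

Lemma killE w : Z - Z' w = \sum_o (live o && (h1 w o || h2 w o))%:R.
Proof.
rewrite /Z /Z' -sumrB; apply: eq_bigr => o _.
by case: (live o) (h1 w o) (h2 w o) => [] [] []; rewrite /= ?subrr ?subr0.
Qed.

Lemma kill_bounds w (b1 b2 : R) :
  \sum_o (h1 w o)%:R <= b1 -> \sum_o (h2 w o)%:R <= b2 ->
  0 <= Z - Z' w <= b1 + b2.
Proof.
move=> hb1 hb2; rewrite killE sumr_ge0 //=.
apply: le_trans (lerD hb1 hb2); rewrite -big_split /=; apply: ler_sum => o _.
by case: (live o) (h1 w o) (h2 w o) => [] [] []; rewrite /= -natrD ler_nat.
Qed.

Hypothesis mu_ge0 : forall w, 0 <= mu w.

Lemma kill_upper (r1 r2 : R) :
  (forall o, live o -> \sum_w mu w * (h1 w o)%:R <= r1) ->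
  (forall o, live o -> \sum_w mu w * (h2 w o)%:R <= r2) ->
  \sum_w mu w * (Z - Z' w) <= Z * (r1 + r2).
Proof.
move=> hr1 hr2; under eq_bigr do rewrite killE mulr_sumr.
rewrite exchange_big /= /Z mulr_suml; apply: ler_sum => o _.
have [lo|nlo] := boolP (live o); last first.
  by rewrite mul0r big1 // => w _; rewrite mulr0.
rewrite mul1r; apply: le_trans (lerD (hr1 o lo) (hr2 o lo)).
rewrite -big_split /=; apply: ler_sum => w _; rewrite -mulrDr ler_wpM2l //.
by case: (h1 w o) (h2 w o) => [] []; rewrite /= -natrD ler_nat.
Qed.

(** Inclusion-exclusion: adding the two probabilities counts twice the objects hit in both ways,
    whose expected number is at most [D]. *)
Lemma kill_lower (r1 r2 D : R) :
  (forall o, live o -> r1 <= \sum_w mu w * (h1 w o)%:R) ->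
  (forall o, live o -> r2 <= \sum_w mu w * (h2 w o)%:R) ->
  \sum_w mu w * (\sum_o (live o && h1 w o && h2 w o)%:R) <= D ->
  Z * (r1 + r2) - D <= \sum_w mu w * (Z - Z' w).
Proof.
move=> hr1 hr2 hD; rewrite lerBlDr; apply: le_trans (lerD (lexx _) hD).
rewrite -big_split /=; under eq_bigr do rewrite killE -mulrDr -big_split mulr_sumr /=.
rewrite exchange_big /= /Z mulr_suml; apply: ler_sum => o _.
have [lo|nlo] := boolP (live o); last first.
  by rewrite mul0r big1 // => w _; rewrite addr0 mulr0.
rewrite mul1r; apply: le_trans (lerD (hr1 o lo) (hr2 o lo)) _.
rewrite -big_split /=; apply: ler_sum => w _; rewrite -mulrDr ler_wpM2l //.
by case: (h1 w o) (h2 w o) => [] []; rewrite /= -!natrD ler_nat.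
Qed.

End Kills.

(* I is the set of rows, and T stands at once for the cells of a row, the
   columns, the symbols and the colours.  A vertex v : T is a column if b = false
   and a symbol if b = true; P b i c is the vertex of type b of the cell c of row
   i.  A state is a set A of coloured rows together with the predicate al, where
   al b v k means that colour k is unused at the vertex v of type b.  A step
   w = (i, s) gives colour s c to each cell c of row i. *)
Section Process.
Variables (R : realFieldType) (I T : finType) (P : bool -> I -> {perm T}).
Implicit Types (A : {set I}) (al : bool -> T -> T -> bool).
Implicit Types (w : I * {perm T}) (b : bool) (i : I) (c k v : T).

Definition slot b i v := ((P b i)^-1)%g v.
Definition partner b i v := P (~~ b) i (slot b i v).
Definition edge al i c k := al false (P false i c) k && al true (P true i c) k.
Definition hit w b v k := w.2 (slot b w.1 v) == k.
Definition upd al w b v k := al b v k && ~~ hit w b v k.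

Definition var : finType := ((I * T + I * T) + (bool * T * T) + (I * T * T))%type.
Definition two_sided (q : var) := if q is inr _ then false else true.

(* In order: the degree of a cell, the degree of a colour in a row, the number
   of uncoloured rows where k is unused at the partner of v, and the number of
   colours available at both of two cells of a row. *)
Definition survivors A al (q : var) : R :=
  match q with
  | inl (inl (inl (i, c))) => \sum_k (edge al i c k)%:R
  | inl (inl (inr (i, k))) => \sum_c (edge al i c k)%:R
  | inl (inr (b, v, k)) =>
      \sum_i ((i \notin A) && al (~~ b) (partner b i v) k)%:R
  | inr (i, c, c') => \sum_k (edge al i c k && edge al i c' k)%:R
  end.

(* Relative decrease per step when each (vertex, colour) pair is used up with
   probability x and each uncoloured row is chosen with probability y. *)
Definition rate (x y : R) (q : var) : R :=
  match q with
  | inl (inl _) => 2 * x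
  | inl (inr _) => x + y
  | inr _ => 4 * x
  end.

(** All that the analysis uses of a random step: [x] is the ideal probability that an available pair
    (vertex, colour) is used up, [err] the deviation allowed, and [dmax] a cruder bound that holds
    for every pair. *)
Record choice_ok A al (x err dmax : R) (mu : I * {perm T} -> R) : Prop :=
  ChoiceOk {
    mu_ge0 : forall w, 0 <= mu w;
    mu_sum : \sum_w mu w = 1;
    mu_supp : forall w, 0 < mu w ->
      w.1 \notin A /\ forall c, edge al w.1 c (w.2 c);
    mu_row : forall i, \sum_w mu w * (w.1 == i)%:R
      = (i \notin A)%:R / #|~: A|%:R;
    mu_hit_le : forall b v k, \sum_w mu w * (hit w b v k)%:R <= dmax;
    mu_hit : forall b v k, al b v k ->
      `|\sum_w mu w * (hit w b v k)%:R - x| <= err }.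

(** The column condition on J, in a form symmetric in columns and symbols: a column meets a symbol
    in at most one row. *)
Definition compat := forall i i' c c',
  P false i c = P false i' c' -> P true i c = P true i' c' -> i = i'.

Lemma slotK b i : cancel (P b i) (slot b i).
Proof. exact: permK. Qed.

Lemma slotKV b i : cancel (slot b i) (P b i).
Proof. exact: permKV. Qed.

Lemma slot_inj b i : injective (slot b i).
Proof. exact: perm_inj. Qed.

Lemma slot_partner b i v : slot (~~ b) i (partner b i v) = slot b i v.
Proof. exact: slotK. Qed.

Hypothesis P_compat : compat.

Lemma compatb b i i' c c' :
  P b i c = P b i' c' -> P (~~ b) i c = P (~~ b) i' c' -> i = i'.
Proof. by case: b => /= e1 e2; [apply: P_compat e2 e1|apply: P_compat e1 e2]. Qed.

Lemma partner_inj b v : injective (fun i => partner b i v).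
Proof.
move=> i i' /= e; apply: (@compatb b i i' (slot b i v) (slot b i' v)) => //.
by rewrite !slotKV.
Qed.

Lemma hits_le1 (O : finType) (f : O -> T) (k : T) : injective f ->
  \sum_o (f o == k)%:R <= 1 :> R.
Proof.
move=> fI; have [o0 /eqP fo0|no] := pickP (fun o => f o == k).
  rewrite (bigD1 o0) //= fo0 eqxx big1 ?addr0 // => o; rewrite -fo0.
  by rewrite (inj_eq fI) => /negPf ->.
by rewrite big1 ?ler01 // => o _; rewrite no.
Qed.

Lemma hits_row_le1 w : \sum_i (w.1 == i)%:R <= 1 :> R.
Proof.
rewrite (bigD1 w.1) //= eqxx big1 ?addr0 // => i.
by rewrite eq_sym => /negPf ->.
Qed.

Lemma hits_color_le1 w b v : \sum_k (hit w b v k)%:R <= 1 :> R.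
Proof.
rewrite (bigD1 (w.2 (slot b w.1 v))) //= /hit eqxx big1 ?addr0 // => k.
by rewrite eq_sym => /negPf ->.
Qed.

Lemma hits_cell_le1 w b i k : \sum_c (hit w b (P b i c) k)%:R <= 1 :> R.
Proof. by apply: hits_le1 => c c' /perm_inj/slot_inj/perm_inj. Qed.

Lemma hits_partner_le1 w b v k :
  \sum_i (hit w (~~ b) (partner b i v) k)%:R <= 1 :> R.
Proof. by apply: hits_le1 => i i' /perm_inj/slot_inj/partner_inj. Qed.

(** A step uses [k] in only one cell of its row, so that cell shares both column and symbol with the
    cell [c] of row [i]. *)
Lemma double_hit w i c k :
  hit w false (P false i c) k -> hit w true (P true i c) k -> w.1 = i.
Proof.
move=> /eqP h1 /eqP; rewrite -h1 => /perm_inj e.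
apply: (@P_compat _ _ (slot false w.1 (P false i c)) c); rewrite ?slotKV //.
by rewrite -e slotKV.
Qed.

Lemma edge_upd al w i c k : edge (upd al w) i c k =
  edge al i c k && ~~ hit w false (P false i c) k && ~~ hit w true (P true i c) k.
Proof.
rewrite /edge /upd; case: (al false _ _) (al true _ _) => [] [] //=.
by rewrite !andbF.
Qed.

Definition hit_cell i c w k :=
  hit w false (P false i c) k || hit w true (P true i c) k.

Lemma edge2_upd al w i c c' k :
  edge (upd al w) i c k && edge (upd al w) i c' k =
  (edge al i c k && edge al i c' k) && ~~ hit_cell i c w k && ~~ hit_cell i c' w k.
Proof.
rewrite !edge_upd /hit_cell !negb_or.
by case: (edge al i c k) (edge al i c' k) => [] [] //=; rewrite ?andbF.
Qed.

Lemma row_upd A al w b i v k :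
  (i \notin w.1 |: A) && upd al w (~~ b) (partner b i v) k =
  ((i \notin A) && al (~~ b) (partner b i v) k) && ~~ (w.1 == i)
    && ~~ hit w (~~ b) (partner b i v) k.
Proof.
rewrite /upd in_setU1 negb_or (eq_sym i).
by case: (w.1 == i) (i \in A) => [] []; rewrite /= ?andbF ?andbT.
Qed.

Lemma hits_cell2_le w i c : \sum_k (hit_cell i c w k)%:R <= 2 :> R.
Proof.
have := lerD (hits_color_le1 w false (P false i c))
             (hits_color_le1 w true (P true i c)).
apply: le_trans; rewrite -big_split /=; apply: ler_sum => k _.
by rewrite /hit_cell; case: (hit _ _ _ _) (hit _ _ _ _) => [] [];
  rewrite -natrD ler_nat.
Qed.

(** Each way of destroying a counted object removes at most one object per step, and there are at
    most four ways: one for each vertex of two cells. *)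
Lemma survivors_drop A al w (q : var) :
  0 <= survivors A al q - survivors (w.1 |: A) (upd al w) q <= 4.
Proof.
have le4 (x y : R) : 0 <= x <= y -> y <= 4 -> 0 <= x <= 4.
  by move=> /andP[-> xy] /(le_trans xy).
case: q => [[[[i c]|[i k]]|[[b v] k]]|[[i c] c']] /=.
- under [X in _ - X]eq_bigr do rewrite edge_upd.
  apply: le4 (kill_bounds (edge al i c)
      (h1 := fun w k => hit w false (P false i c) k)
      (h2 := fun w k => hit w true (P true i c) k)
      (hits_color_le1 w false (P false i c)) (hits_color_le1 w true (P true i c))) _.
  by lra.
- under [X in _ - X]eq_bigr do rewrite edge_upd.
  apply: le4 (kill_bounds (edge al i ^~ k)
      (h1 := fun w c => hit w false (P false i c) k)
      (h2 := fun w c => hit w true (P true i c) k)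
      (hits_cell_le1 w false i k) (hits_cell_le1 w true i k)) _.
  by lra.
- under [X in _ - X]eq_bigr do rewrite row_upd.
  apply: le4 (kill_bounds (fun i => (i \notin A) && al (~~ b) (partner b i v) k)
      (h1 := fun w i => w.1 == i)
      (h2 := fun w i => hit w (~~ b) (partner b i v) k)
      (hits_row_le1 w) (hits_partner_le1 w b v k)) _.
  by lra.
- under [X in _ - X]eq_bigr do rewrite edge2_upd.
  apply: le4 (kill_bounds (fun k => edge al i c k && edge al i c' k)
      (h1 := hit_cell i c) (h2 := hit_cell i c')
      (hits_cell2_le w i c) (hits_cell2_le w i c')) _.
  by lra.
Qed.

(** Linearity of expectation over the counted objects. The loss dmax + y in the lower bound pays for
    objects destroyed in two ways at once. *)
Lemma survivors_drift A al (x err dmax : R) mu (q : var) :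
  choice_ok A al x err dmax mu -> 0 <= err -> 0 <= dmax ->
  let K w := survivors A al q - survivors (w.1 |: A) (upd al w) q in
  let y := #|~: A|%:R^-1 in
  \sum_w mu w * K w <= survivors A al q * (rate x y q + 4 * err) /\
  (two_sided q -> survivors A al q * (rate x y q - 4 * err) - (dmax + y)
        <= \sum_w mu w * K w).
Proof.
move=> [mu0 mu1 _ mur mud muh] err0 d0 K y.
have y0 : 0 <= y by rewrite invr_ge0.
have hitU b v k : al b v k -> \sum_w mu w * (hit w b v k)%:R <= x + err.
  by move=> /muh; rewrite ler_distl => /andP[].
have hitL b v k : al b v k -> x - err <= \sum_w mu w * (hit w b v k)%:R.
  by move=> /muh; rewrite ler_distl => /andP[].
have survivors_ge0 : 0 <= survivors A al q.
  by case: q {K} => [[[[]|[]]|[[]]]|[[]]] *; apply: sumr_ge0.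
(* For the degrees: a double hit occurs only if row [i] is chosen, and then for at most one
   object. *)
have dbl_row (O : finType) (D : I * {perm T} -> O -> bool)
    (h : I * {perm T} -> O -> bool) i :
    (forall w, \sum_o (h w o)%:R <= 1 :> R) ->
    (forall w o, D w o -> h w o && (w.1 == i)) ->
    \sum_w mu w * \sum_o (D w o)%:R <= dmax + y.
  move=> hle hD; apply: (@le_trans _ _ (\sum_w mu w * (w.1 == i)%:R)).
    apply: ler_sum => w _; rewrite ler_wpM2l //.
    apply: (@le_trans _ _ (\sum_o (h w o)%:R * (w.1 == i)%:R)).
      apply: ler_sum => o _; case: (D w o) (hD w o) => [/(_ isT)/andP[-> ->]|_].
        by rewrite mulr1.
      by rewrite mulr_ge0.
    by rewrite -mulr_suml ler_piMl.
  rewrite mur; apply: (@le_trans _ _ y); last by rewrite lerDr.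
  by rewrite -/y; case: (_ \notin _); rewrite ?mul1r // mul0r.
case: q @K survivors_ge0 => [[[[i c]|[i k]]|[[b v] k]]|[[i c] c']] K Z0; rewrite /K /=.
- have eK w : \sum_k (edge (upd al w) i c k)%:R =
     \sum_k (edge al i c k && ~~ hit w false (P false i c) k
         && ~~ hit w true (P true i c) k)%:R :> R.
    by apply: eq_bigr => k _; rewrite edge_upd.
  split=> [|_].
  + under eq_bigr do rewrite eK.
    apply: (@le_trans _ _ (_ * ((x + err) + (x + err)))); first apply: kill_upper => //.
    * by move=> k /andP[? _]; apply: hitU.
    * by move=> k /andP[_ ?]; apply: hitU.
    by rewrite ler_wpM2l //; lra.
  under [X in _ <= X]eq_bigr do rewrite eK.
  apply: le_trans (kill_lower (r1 := x - err) (r2 := x - err) (D := dmax + y) mu0 _ _ _).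
  + by rewrite lerD2r ler_wpM2l //; lra.
  + by move=> k /andP[? _]; apply: hitL.
  + by move=> k /andP[_ ?]; apply: hitL.
  apply: (dbl_row _ _ (fun w => hit w false (P false i c)) i) => [w|w k].
    exact: hits_color_le1.
  by move=> /andP[/andP[_ h1] h2]; rewrite h1 (double_hit h1 h2) eqxx.
- have eK w : \sum_c (edge (upd al w) i c k)%:R =
     \sum_c (edge al i c k && ~~ hit w false (P false i c) k
         && ~~ hit w true (P true i c) k)%:R :> R.
    by apply: eq_bigr => c _; rewrite edge_upd.
  split=> [|_].
  + under eq_bigr do rewrite eK.
    apply: (@le_trans _ _ (_ * ((x + err) + (x + err)))).
      apply: (kill_upper (live := edge al i ^~ k)
        (h1 := fun w c => hit w false (P false i c) k)
        (h2 := fun w c => hit w true (P true i c) k)) => //.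
      * by move=> c /andP[? _]; apply: hitU.
      * by move=> c /andP[_ ?]; apply: hitU.
    by rewrite ler_wpM2l //; lra.
  under [X in _ <= X]eq_bigr do rewrite eK.
  apply: le_trans (kill_lower (live := edge al i ^~ k)
        (h1 := fun w c => hit w false (P false i c) k)
        (h2 := fun w c => hit w true (P true i c) k)
        (r1 := x - err) (r2 := x - err) (D := dmax + y) mu0 _ _ _).
  + by rewrite lerD2r ler_wpM2l //; lra.
  + by move=> c /andP[? _]; apply: hitL.
  + by move=> c /andP[_ ?]; apply: hitL.
  apply: (dbl_row _ _ (fun w c => hit w false (P false i c) k) i) => [w|w c].
    exact: hits_cell_le1.
  by move=> /andP[/andP[_ h1] h2]; rewrite h1 (double_hit h1 h2) eqxx.
- set live := fun i => (i \notin A) && al (~~ b) (partner b i v) k.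
  have eK w : \sum_i ((i \notin w.1 |: A) && upd al w (~~ b) (partner b i v) k)%:R =
     \sum_i (live i && ~~ (w.1 == i) && ~~ hit w (~~ b) (partner b i v) k)%:R :> R.
    by apply: eq_bigr => i _; rewrite row_upd.
  split=> [|_].
  + under eq_bigr do rewrite eK.
    apply: (@le_trans _ _ (_ * (y + (x + err)))).
      apply: (kill_upper (live := live)
        (h1 := fun w i => w.1 == i)
        (h2 := fun w i => hit w (~~ b) (partner b i v) k)) => //.
      * by move=> i /andP[iA _]; rewrite mur iA mul1r.
      * by move=> i /andP[_ ?]; apply: hitU.
    by rewrite ler_wpM2l //; lra.
  under [X in _ <= X]eq_bigr do rewrite eK.
  apply: le_trans (kill_lower (live := live)
        (h1 := fun w i => w.1 == i)
        (h2 := fun w i => hit w (~~ b) (partner b i v) k)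
        (r1 := y) (r2 := x - err) (D := dmax + y) mu0 _ _ _).
  + by rewrite lerD2r ler_wpM2l //; lra.
  + by move=> i /andP[iA _]; rewrite mur iA mul1r.
  + by move=> i /andP[_ ?]; apply: hitL.
  (* If row [i] is chosen and the partner of [v] in it receives [k], then the same cell gives [k] to
     [v]. So double hits require a hit of (v, k) itself. *)
  apply: (@le_trans _ _ dmax); last by rewrite lerDl.
  apply: le_trans (mud b v k); apply: ler_sum => w _; rewrite ler_wpM2l //.
  rewrite (bigD1 w.1) //= big1 ?addr0 => [|i /negPf]; last first.
    by rewrite eq_sym => ->; rewrite andbF.
  rewrite /hit slot_partner -/(hit w b v k) ler_nat.
  by case: (hit w b v k); rewrite ?andbF //; case: (_ && _).
- set live := fun k => edge al i c k && edge al i c' k.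
  have eK w : \sum_k (edge (upd al w) i c k && edge (upd al w) i c' k)%:R =
     \sum_k (live k && ~~ hit_cell i c w k && ~~ hit_cell i c' w k)%:R :> R.
    by apply: eq_bigr => k _; rewrite edge2_upd.
  have hE c1 k : edge al i c1 k -> \sum_w mu w * (hit_cell i c1 w k)%:R <= 2 * x + 2 * err.
    move=> /andP[/hitU a1 /hitU a2]; have := lerD a1 a2.
    have -> : x + err + (x + err) = 2 * x + 2 * err by ring.
    apply: le_trans; rewrite -big_split /=; apply: ler_sum => w _.
    rewrite -mulrDr ler_wpM2l // /hit_cell.
    by case: (hit _ _ _ _) (hit _ _ _ _) => [] []; rewrite -natrD ler_nat.
  split=> //.
  + under eq_bigr do rewrite eK.
    apply: (@le_trans _ _ (_ * ((2 * x + 2 * err) + (2 * x + 2 * err)))).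
      apply: kill_upper => // k /andP[? ?]; exact: hE.
    by rewrite ler_wpM2l //; lra.
Qed.

End Process.

(** * Random rows and random matchings *)

Lemma random_perm (R : realFieldType) (T : finType) (G : T -> T -> bool)
    (d kap eta : R) (n := #|T|%:R : R) :
  0 < kap -> 0 < d <= n -> 0 <= eta -> (2 + 8 / kap) * eta <= 1 ->
  (forall j, `|\sum_k (G j k)%:R - d| <= eta * d) ->
  (forall k, `|\sum_j (G j k)%:R - d| <= eta * d) ->
  (forall j j', kap * n <= \sum_k (G j k && G j' k)%:R) ->
  exists c : {perm T} -> R, [/\ forall s, 0 <= c s, \sum_s c s = 1,
    forall s j, 0 < c s -> G j (s j) &
    forall j k, if G j k
      then `|\sum_s c s * (s j == k)%:R - d^-1| <= (2 + 8 / kap) * eta / d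
      else \sum_s c s * (s j == k)%:R == 0].
Proof.
move=> kap0 dn eta0 eta1 degr degc codeg.
have [p [p0 pr pc pG pd]] := balanced_weights kap0 dn eta0 eta1 degr degc codeg.
have [c [c0 c_sub c_sum]] := birkhoff ler01 p0 pr pc.
exists c; split=> //.
- have [j _|T0] := pickP (fun _ : T => true); last first.
    case/andP: dn => d0 /(lt_le_trans d0); rewrite /n.
    by rewrite (eq_card0 (A := T)) ?ltxx // => j; have := T0 j.
  rewrite -(pr j); under [RHS]eq_bigr do rewrite -c_sum.
  rewrite exchange_big /=; apply: eq_bigr => s _.
  rewrite -mulr_sumr (bigD1 (s j)) //= eqxx big1 ?addr0 ?mulr1 // => k.
  by rewrite eq_sym => /negPf ->.
- move=> s j /(c_sub s j); have [//|/pG ->] := boolP (G j (s j)).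
  by rewrite ltxx.
- by move=> j k; rewrite c_sum; case: ifPn => [/pd|/pG ->].
Qed.

Section Choice.
Variables (R : realFieldType) (I T : finType) (P : bool -> I -> {perm T}).
Local Notation survivors := (@survivors R I T P).
Local Notation edge := (edge P).
Local Notation slot := (slot P).
Local Notation partner := (partner P).
Variables (A : {set I}) (al : bool -> T -> T -> bool).

Lemma edge_slot b i v k : edge al i (slot b i v) k =
  al b v k && al (~~ b) (partner b i v) k.
Proof.
rewrite /edge /partner; case: b => /=; rewrite slotKV //.
by rewrite andbC.
Qed.

(** Origin of f / (N d): each uncoloured row is chosen with probability 1 / N, about [f] of them
    have [k] available at the partner of [v], and there the matching uses the pair with probability
    about 1 / d. The matching contributes 2 C eta to the relative error, the deviation from [f]
    another eta. *)
Lemma choice_exists (d f kap eta : R)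
    (n := #|T|%:R : R) (N := #|~: A|%:R : R) (C := 2 + 8 / kap) :
  0 < N -> 0 < f -> 0 < kap -> 0 < d <= n -> 0 <= eta -> C * eta <= 1 ->
  (forall i c, i \notin A -> `|survivors A al (inl (inl (inl (i, c)))) - d| <= eta * d) ->
  (forall i k, i \notin A -> `|survivors A al (inl (inl (inr (i, k)))) - d| <= eta * d) ->
  (forall b v k, `|survivors A al (inl (inr (b, v, k))) - f| <= eta * f) ->
  (forall i c c', i \notin A -> kap * n <= survivors A al (inr (i, c, c'))) ->
  exists mu, choice_ok P A al (f / (N * d))
               ((2 * C + 1) * eta * (f / (N * d))) (2 / d) mu.
Proof.
move=> N0 f0 kap0 dn eta0 Ceta hX hY hD hW.
have d0 : 0 < d by case/andP: dn.
have C2 : 2 <= C by rewrite lerDl divr_ge0 // ltW.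
have eta_half : eta <= 1 / 2.
  by have := ler_wpM2r eta0 C2; lra.
(* The condition on [i] stays under the existential so that a choice function exists on all rows;
   coloured rows get the dummy value 0. *)
have Pc i : exists c : {perm T} -> R, i \notin A -> [/\ forall s, 0 <= c s,
    \sum_s c s = 1, forall s j, 0 < c s -> edge al i j (s j) &
    forall j k, if edge al i j k
      then `|\sum_s c s * (s j == k)%:R - d^-1| <= C * eta / d
      else \sum_s c s * (s j == k)%:R == 0].
  have [iA|iA] := boolP (i \in A); first by exists (fun=> 0).
  have [c hc] := random_perm kap0 dn eta0 Ceta
    (fun c => hX i c iA) (fun k => hY i k iA) (fun c c' => hW i c c' iA).
  by exists c.
have [c hc] := fin_all_exists Pc.
pose mu (w : I * {perm T}) := (w.1 \notin A)%:R / N * c w.1 w.2.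
have sum_mu (F : I -> {perm T} -> R) : \sum_w mu w * F w.1 w.2 =
    N^-1 * \sum_(i | i \notin A) \sum_s c i s * F i s.
  rewrite mulr_sumr [RHS]big_mkcond /=.
  rewrite -(pair_bigA _ (fun i s => mu (i, s) * F i s)) /=.
  apply: eq_bigr => i _; rewrite /mu /=; case: (i \notin A); last first.
    by rewrite big1 // => s _; rewrite !mul0r.
  by rewrite mulr_sumr; apply: eq_bigr => s _; rewrite mul1r mulrA.
have sumN : \sum_(i | i \notin A) 1 = N :> R.
  rewrite sumr_const /N; congr (_ *+ _); apply: eq_card => i.
  by rewrite !inE.
have sum_hit b v k : \sum_w mu w * (hit P w b v k)%:R =
    N^-1 * \sum_(i | i \notin A) \sum_s c i s * (s (slot b i v) == k)%:R.
  exact: (sum_mu (fun i s => (s (slot b i v) == k)%:R)).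
exists mu; split.
- move=> w; rewrite /mu; have [iA|iA] := boolP (w.1 \in A).
    by rewrite !mul0r.
  by have [c0 _ _ _] := hc _ iA; rewrite mulr_ge0 ?divr_ge0 // ltW.
- transitivity (\sum_w mu w * 1); first by apply: eq_bigr => w _; rewrite mulr1.
  rewrite (sum_mu (fun _ _ => 1)).
  rewrite (eq_bigr (fun=> 1)) ?sumN ?mulVf ?gt_eqF // => i iA.
  have [_ c1 _ _] := hc _ iA; rewrite -[RHS]c1.
  by apply: eq_bigr => s _; rewrite mulr1.
- move=> w; rewrite /mu; have [iA|iA] := boolP (w.1 \in A).
    by rewrite !mul0r ltxx.
  have [c0 _ c_sub _] := hc _ iA; rewrite mul1r pmulr_rgt0 ?invr_gt0 // => cw.
  by split=> // j; apply: c_sub.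
- move=> i; rewrite (sum_mu (fun i' _ => (i' == i)%:R)) mulrC; congr (_ / _).
  rewrite (eq_bigr (fun i' => (i' == i)%:R)); last first.
    move=> i' iA; have [_ c1 _ _] := hc _ iA.
    by rewrite -mulr_suml c1 mul1r.
  have [iA|iA] := boolP (i \in A); last first.
    rewrite (bigD1 i) //= eqxx big1 ?addr0 // => i' /andP[_ /negPf ->//].
  rewrite big1 // => i'; case: eqP => // ->; by rewrite iA.
- move=> b v k; rewrite sum_hit mulrC ler_pdivrMr //.
  rewrite mulrC -sumN mulr_suml; apply: ler_sum => i iA; rewrite mul1r.
  have [_ _ _] := hc _ iA => /(_ (slot b i v) k); case: ifP => _ => [|/eqP ->].
    rewrite ler_distl => /andP[_ /le_trans]; apply.
    have -> : 2 / d = d^-1 + 1 / d by field; rewrite gt_eqF.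
    by rewrite lerD2l ler_pM2r ?invr_gt0.
  by rewrite divr_ge0 // ltW.
- move=> b v k bvk; rewrite sum_hit.
  set S := \sum_(i | _) _; set D := survivors A al (inl (inr (b, v, k))).
  have SD : `|S - D / d| <= D * (C * eta / d).
    rewrite /S /D /= big_mkcond /= mulr_suml mulr_suml -sumrB.
    apply: le_trans (ler_norm_sum _ _ _) _; apply: ler_sum => i _.
    have [iA|iA] := boolP (i \in A); first by rewrite !mul0r subr0 normr0.
    have [_ _ _ /(_ (slot b i v) k)] := hc _ iA; rewrite edge_slot bvk /=.
    by case: (al _ _ _) => [|/eqP ->]; rewrite ?mul1r // !mul0r subr0 normr0.
  have := hD b v k; rewrite -/D ler_distl => /andP[D1 D2].
  have -> : N^-1 * S - f / (N * d) = (S - D / d + (D - f) / d) / N.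
    by field; rewrite !gt_eqF.
  rewrite normrM normfV (gtr0_norm N0) ler_pdivrMr //.
  apply: le_trans (ler_normD _ _) _.
  have e1 : `|(D - f) / d| <= eta * f / d.
    rewrite normrM normfV (gtr0_norm d0) ler_pM2r ?invr_gt0 //; exact: hD.
  have e2 : D * (C * eta / d) <= 2 * f * (C * eta / d).
    rewrite ler_wpM2r //; first by rewrite divr_ge0 ?mulr_ge0 //; lra.
    by have : eta * f <= 1 / 2 * f; [rewrite ler_pM2r|lra].
  have -> : (2 * C + 1) * eta * (f / (N * d)) * N =
      2 * f * (C * eta / d) + eta * f / d by field; rewrite !gt_eqF.
  by lra.
Qed.

End Choice.

(** * The exponential potential *)

Section Exp.
Variable R : realType.

(** From exp(-x) >= 1 - x follows exp(x) <= 1 / (1 - x), and (1 + x + 2 x^2)(1 - x) >= 1 for x <=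
    1/2. *)
Lemma expR_le_quad (x : R) : `|x| <= 1 / 2 -> expR x <= 1 + x + 2 * x ^+ 2.
Proof.
rewrite ler_norml => /andP[x1 x2].
have e0 := expR_gt0 (- x); have e1 := expR_ge1Dx (- x).
have : expR x * expR (- x) = 1 by rewrite -expRD subrr expR0.
have x0 : 0 < 1 - x by lra.
move=> h; have ex0 := expR_gt0 x.
have : expR x * (1 - x) <= 1 by rewrite -[leRHS]h ler_pM2l.
rewrite -ler_pdivlMr // => /le_trans; apply; rewrite ler_pdivrMr //.
have -> : (1 + x + 2 * x ^+ 2) * (1 - x) = 1 + x ^+ 2 * (1 - 2 * x) by ring.
by rewrite lerDl mulr_ge0 ?sqr_ge0 //; lra.
Qed.

(** Supermartingale step: raising the threshold by [delta] compensates both the drift [A] and the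
    quadratic term of the exponential. *)
Lemma exp_step (W : finType) (mu D : W -> R) (lam B A x eta delta : R) :
  (forall w, 0 <= mu w) -> \sum_w mu w = 1 -> 0 <= lam ->
  (forall w, `|D w| <= B) -> lam * B <= 1 / 2 ->
  \sum_w mu w * D w <= A -> A + 2 * lam * B ^+ 2 <= delta ->
  \sum_w mu w * expR (lam * (x + D w - (eta + delta)))
    <= expR (lam * (x - eta)).
Proof.
move=> mu0 mu1 lam0 hB lamB hA hd.
have -> : lam * (x - eta) = lam * (x - (eta + delta)) + lam * delta by ring.
rewrite expRD.
rewrite (eq_bigr (fun w => expR (lam * (x - (eta + delta))) *
    (mu w * expR (lam * D w)))); last first.
  by move=> w _; rewrite mulrCA -expRD; congr (_ * expR _); ring.
rewrite -mulr_sumr ler_pM2l ?expR_gt0 //.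
apply: (@le_trans _ _ (1 + lam * delta)); last exact: expR_ge1Dx.
apply: (@le_trans _ _ (\sum_w mu w * (1 + lam * D w + 2 * (lam * B) ^+ 2))).
  apply: ler_sum => w _; rewrite ler_wpM2l //.
  have lD : `|lam * D w| <= lam * B by rewrite normrM ger0_norm // ler_wpM2l.
  apply: le_trans (expR_le_quad _) _; first exact: le_trans lamB.
  rewrite lerD2l ler_wpM2l // -[_ ^+ 2]real_normK ?num_real //.
  by rewrite lerXn2r ?nnegrE // (le_trans _ lD).
under eq_bigr do rewrite mulrDr mulrDr mulr1 (mulrCA (mu _)).
rewrite !big_split /= mu1 -mulr_sumr -mulr_suml mu1 mul1r -addrA lerD2l.
have -> : lam * (\sum_w mu w * D w) + 2 * (lam * B) ^+ 2 =
  lam * (\sum_w mu w * D w + 2 * lam * B ^+ 2) by ring.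
by rewrite ler_wpM2l //; lra.
Qed.

End Exp.

(** Positive weight of the outcome matters: only such outcomes are known to be legal steps. *)
Lemma average_le (R : realFieldType) (W : finType) (mu F : W -> R) (x : R) :
  (forall w, 0 <= mu w) -> \sum_w mu w = 1 -> \sum_w mu w * F w <= x ->
  exists2 w, 0 < mu w & F w <= x.
Proof.
move=> mu0 mu1 hF.
have [w /andP[muw Fw]|no] := pickP (fun w => (0 < mu w) && (F w <= x)).
  by exists w.
have F_gt w : 0 < mu w -> x < F w.
  by move=> muw; have := no w; rewrite muw /= leNgt => /negbFE.
have ge w : 0 <= mu w * (F w - x).
  have := mu0 w; rewrite le_eqVlt => /predU1P[<-|muw]; first by rewrite mul0r.
  by rewrite mulr_ge0 // subr_ge0 ltW // F_gt.
have sum0 : \sum_w mu w * (F w - x) = 0.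
  apply/eqP; rewrite eq_le sumr_ge0 // andbT.
  under eq_bigr do rewrite mulrBr.
  by rewrite sumrB -mulr_suml mu1 mul1r subr_le0.
have mu_eq0 w : mu w = 0.
  apply/eqP; move/eqP: sum0; rewrite psumr_eq0 // => /allP/(_ w (mem_index_enum w)).
  rewrite mulf_eq0 subr_eq0 => /orP[//|/eqP Fx].
  have := mu0 w; rewrite le_eqVlt eq_sym => /orP[//|/F_gt].
  by rewrite Fx ltxx.
by move: mu1; rewrite big1 // => /eqP; rewrite eq_sym oner_eq0.
Qed.

(** * The ideal trajectory of the counts *)

Section Trajectory.
Variables (R : realFieldType) (I T : finType).
Implicit Types (n u N a : R) (q : var I T).

(* u is the number of colours unused at each vertex, and N the number of
   uncoloured rows. *)
Definition traj n u N q : R :=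
  match q with
  | inl (inl _) => u ^+ 2 / n
  | inl (inr _) => N * u / n
  | inr _ => u ^+ 4 / n ^+ 3
  end.

Lemma traj_lb n u N a q : 0 < a <= 1 -> 0 < n -> a * n <= u -> a * n <= N ->
  a ^+ 4 * n <= traj n u N q.
Proof.
move=> /andP[a0 a1] n0 hu hN.
have an0 : 0 < a * n by apply: mulr_gt0.
have u0 : 0 < u by apply: lt_le_trans hu.
have N0 : 0 < N by apply: lt_le_trans hN.
have a4 : a ^+ 4 <= a ^+ 2 by rewrite ler_wiXn2l // ltW.
case: q => [[q|q]|q] /=; rewrite ler_pdivlMr ?exprn_gt0 //.
- apply: (@le_trans _ _ ((a * n) ^+ 2)).
    rewrite exprMn -mulrA -expr2 ler_wpM2r //; exact: sqr_ge0.
  by rewrite lerXn2r ?nnegrE ?(ltW an0) ?(ltW u0).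
- apply: (@le_trans _ _ ((a * n) ^+ 2)).
    rewrite exprMn -mulrA -expr2 ler_wpM2r //; exact: sqr_ge0.
  by rewrite expr2 ler_pM ?(ltW an0).
- rewrite -mulrA -exprS -exprMn lerXn2r ?nnegrE ?(ltW an0) ?(ltW u0) //.
Qed.

(** With x = 1/u and y = 1/N the relative decrease [p] of the trajectory is 1 - (1 - x)^2, 1 - (1 -
    x)(1 - y) or 1 - (1 - x)^4, and [r] is its linear part. *)
Lemma traj_rate n u N a q : 0 < a <= 1 -> 1 <= n -> a * n <= u - 1 ->
  a * n <= N - 1 ->
  let z := traj n u N q in let z' := traj n (u - 1) (N - 1) q in
  let r := rate u^-1 N^-1 q in let p := (z - z') / z in
  [/\ 0 <= p, p <= r, r - p <= 6 / (a * n) ^+ 2 & r <= 4 / (a * n)].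
Proof.
move=> /andP[a0 a1] n1 hu hN z z' r p.
have n0 : 0 < n by apply: lt_le_trans n1.
have an0 : 0 < a * n by apply: mulr_gt0.
have u1 : 1 < u by lra. have N1 : 1 < N by lra.
have u0 : 0 < u by lra. have N0 : 0 < N by lra.
pose x := u^-1; pose y := N^-1; pose e := (a * n)^-1.
have x0 : 0 < x by rewrite invr_gt0. have y0 : 0 < y by rewrite invr_gt0.
have x1 : x < 1 by rewrite invf_lt1. have y1 : y < 1 by rewrite invf_lt1.
have xe : x <= e by rewrite lef_pV2 ?posrE //; lra.
have ye : y <= e by rewrite lef_pV2 ?posrE //; lra.
have -> : 6 / (a * n) ^+ 2 = 6 * e ^+ 2 by rewrite /e exprVn.
rewrite -/e.
have xx : 0 <= x * x <= e ^+ 2.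
  by rewrite mulr_ge0 ?(ltW x0) ?(ltW y0) //= expr2 ler_pM ?(ltW x0) ?(ltW y0).
have xy : 0 <= x * y <= e ^+ 2.
  by rewrite mulr_ge0 ?(ltW x0) ?(ltW y0) //= expr2 ler_pM ?(ltW x0) ?(ltW y0).
case: q @z @z' @r @p => [[q|q]|q] /=; rewrite -/x -/y.
- set p := _ / _; have -> : p = 2 * x - x * x.
    by rewrite /p /x; field; rewrite !gt_eqF.
  have : x * x <= x by rewrite ler_piMl // ltW.
  by split; lra.
- set p := _ / _; have -> : p = x + y - x * y.
    by rewrite /p /x /y; field; rewrite !gt_eqF.
  have : x * y <= x by rewrite ler_piMr // ltW.
  by split; lra.
- set p := _ / _.
  have -> : p = 4 * x - 6 * (x * x) + 4 * (x * x * x) - x * x * (x * x).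
    by rewrite /p /x; field; rewrite !gt_eqF.
  have h1 : 0 <= x * x * x <= x * x by rewrite ler_piMr ?mulr_ge0 ?(ltW x0) ?(ltW x1).
  have h2 : 0 <= x * x * (x * x) <= x * x * x.
    by rewrite !mulrA ler_piMr ?mulr_ge0 ?(ltW x0) ?(ltW x1).
  have h3 : x * x <= x by rewrite ler_piMl // ltW.
  have h4 : 0 <= x - 2 * (x * x) + x * x * x.
    have -> : x - 2 * (x * x) + x * x * x = x * (1 - x) ^+ 2 by ring.
    by rewrite mulr_ge0 ?sqr_ge0 ?(ltW x0).
  by split; lra.
Qed.

End Trajectory.

(** * Evolution of the potential in one step *)

Section Step.
Variables (R : realType) (I T : finType) (P : bool -> I -> {perm T}).
Hypothesis P_compat : compat P.
Local Notation survivors := (@survivors R I T P).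
Let n : R := #|T|%:R.
Implicit Types (A : {set I}) (al : bool -> T -> T -> bool).

Definition remaining A : R := #|~: A|%:R.
Definition unused A : R := n - #|A|%:R.

Definition ratio A al q := survivors A al q / traj n (unused A) (remaining A) q.

(* The common degrees (two_sided q = false) only need a lower bound; an upper
   one would even fail for inr (i, c, c), which counts a plain degree. *)
Definition potential (lam eta : R) A al : R :=
  \sum_q expR (lam * (1 - ratio A al q - eta)) +
  \sum_(q | two_sided q) expR (lam * (ratio A al q - 1 - eta)).

Lemma survivors_ge0 A al q : 0 <= survivors A al q.
Proof. by case: q => [[[[]|[]]|[[]]]|[[]]] *; apply: sumr_ge0. Qed.

Lemma sum_bool_le (O : finType) (p : O -> bool) :
  \sum_o (p o)%:R <= #|O|%:R :> R.
Proof. rewrite -sum1_card natr_sum; apply: ler_sum => o _; rewrite ler_nat; exact: leq_b1. Qed.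

Lemma survivors_le A al q : (#|I| <= #|T|)%N -> survivors A al q <= n.
Proof.
move=> IT; case: q => [[[[i c]|[i k]]|[[b v] k]]|[[i c] c']] /=.
- exact: sum_bool_le.
- exact: sum_bool_le.
- by apply: le_trans (sum_bool_le _) _; rewrite ler_nat.
- exact: sum_bool_le.
Qed.

Lemma potential_lt1 lam eta A al q : 0 < lam -> potential lam eta A al < 1 ->
  1 - eta < ratio A al q /\ (two_sided q -> ratio A al q < 1 + eta).
Proof.
move=> lam0 pot1.
have exp_lt x : expR (lam * x) < 1 -> x < 0.
  by rewrite expR_lt1 pmulr_rlt0.
split=> [|tq].
  suff /exp_lt : expR (lam * (1 - ratio A al q - eta)) < 1 by lra.
  apply: le_lt_trans pot1; rewrite /potential; set X := (X in _ <= _ + X).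
  apply: (@le_trans _ _ (\sum_q expR (lam * (1 - ratio A al q - eta)))).
    by rewrite [leRHS](bigD1 q) //= lerDl sumr_ge0 // => *; apply: expR_ge0.
  by rewrite lerDl sumr_ge0 // => *; apply: expR_ge0.
suff /exp_lt : expR (lam * (ratio A al q - 1 - eta)) < 1 by lra.
apply: le_lt_trans pot1; rewrite /potential; set X := (X in _ <= X + _).
apply: (@le_trans _ _
    (\sum_(q | two_sided q) expR (lam * (ratio A al q - 1 - eta)))).
  by rewrite [leRHS](bigD1 q) //= lerDl sumr_ge0 // => *; apply: expR_ge0.
by rewrite lerDr sumr_ge0 // => *; apply: expR_ge0.
Qed.

(** Error factors of one step, in order: for the matching weights with common degrees at least a^4 n
    / 2, for the hitting probabilities, for the drift of a ratio, and for that drift plus the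
    quadratic term in [exp_step]. *)
Definition Cperm (a : R) := 2 + 8 / (a ^+ 4 / 2).
Definition Chit (a : R) := 2 * Cperm a + 1.
Definition Cdrift (a : R) := (4 * Chit a + 6) / a ^+ 6.
Definition Cgrow (a : R) := (4 * Chit a + 14) / a ^+ 6.

Lemma Cperm_ge2 a : 0 < a -> 2 <= Cperm a.
Proof. by move=> a0; rewrite /Cperm lerDl !divr_ge0 ?exprn_ge0 // ltW. Qed.

Lemma Cgrow_ge0 a : 0 < a -> 0 <= Cgrow a.
Proof.
move=> a0; have := Cperm_ge2 a0; rewrite /Cgrow /Chit => h.
by rewrite divr_ge0 ?exprn_ge0 ?(ltW a0) //; lra.
Qed.

(** On the trajectory d = u^2 / n and f = N u / n, so the hitting probability f / (N d) is 1 / u. *)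
Lemma random_choice (lam a eta : R) A al (u := unused A) (N := remaining A) :
  0 < a <= 1 -> 0 < n -> a * n <= u -> a * n <= N -> 0 < lam -> 0 < eta ->
  Cperm a * eta <= 1 -> potential lam eta A al < 1 ->
  exists mu,
    choice_ok P A al u^-1 (Chit a * eta / u) (2 / (u ^+ 2 / n)) mu.
Proof.
move=> a01 n0 hu hN lam0 eta0 Ceta pot1; have /andP[a0 a1] := a01.
have an0 : 0 < a * n by apply: mulr_gt0.
have u0 : 0 < u by apply: lt_le_trans hu.
have N0 : 0 < N by apply: lt_le_trans hN.
have un : u <= n by rewrite gerBl ler0n.
have a4n : 0 < a ^+ 4 * n by rewrite mulr_gt0 ?exprn_gt0.
have eta_half : eta <= 1 / 2.
  have : 2 * eta <= 1 by apply: le_trans Ceta; rewrite ler_pM2r ?Cperm_ge2.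
  by lra.
have near q := potential_lt1 q lam0 pot1.
have z_ge (q : var I T) := traj_lb q a01 n0 hu hN.
have z0 (q : var I T) : 0 < traj n u N q by apply: lt_le_trans (z_ge q).
have near2 q : two_sided q ->
    `|survivors A al q - traj n u N q| <= eta * traj n u N q.
  move=> tq; have [h1 /(_ tq) h2] := near q; move: h1 h2.
  rewrite /ratio -/u -/N ltr_pdivlMr // ltr_pdivrMr // ler_distl.
  by move=> h1 h2; apply/andP; split; lra.
have xE : N * u / n / (N * (u ^+ 2 / n)) = u^-1.
  by field; rewrite !gt_eqF.
have [||||||||||mu] := @choice_exists R I T P A al (u ^+ 2 / n) (N * u / n)
  (a ^+ 4 / 2) eta; last by rewrite xE; exists mu.
- exact: N0.
- by rewrite divr_gt0 // mulr_gt0.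
- by rewrite divr_gt0 // exprn_gt0.
- by rewrite divr_gt0 ?exprn_gt0 //= ler_pdivrMr // expr2 ler_pM ?(ltW u0).
- exact: ltW.
- exact: Ceta.
- by move=> i c _; apply: (near2 (inl (inl (inl (i, c))))).
- by move=> i k _; apply: (near2 (inl (inl (inr (i, k))))).
- by move=> b v k; apply: (near2 (inl (inr (b, v, k)))).
- move=> i c c' _; have [h _] := near (inr (i, c, c')).
  have := z_ge (inr (i, c, c')); move: h.
  rewrite /ratio -/u -/N ltr_pdivlMr //.
  move: (survivors _ _ _) (traj _ _ _ _) => x z h z_lb.
  have : 1 / 2 * z <= (1 - eta) * z.
    rewrite ler_pM2r ?(lt_le_trans a4n) //.
    by lra.
  have -> : a ^+ 4 / 2 * #|T|%:R = 1 / 2 * (a ^+ 4 * n) by rewrite -/n; field.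
  by lra.
Qed.

(** The change of a ratio is (Z p - K) / z', where [K] is the actual loss and [p] the relative loss
    of the trajectory. The expectation of [K] is close to [Z] times the rate, which is close to [p],
    so the main terms cancel. *)
Lemma ratio_drift (a eta : R) A al mu (u := unused A) (N := remaining A)
    (D := fun (q : var I T) (w : I * {perm T}) =>
      survivors (w.1 |: A) (upd P al w) q / traj n (u - 1) (N - 1) q
        - ratio A al q) :
  (#|I| <= #|T|)%N -> 0 < a <= 1 -> 0 < n -> n^-1 <= eta ->
  a * n <= u - 1 -> a * n <= N - 1 ->
  choice_ok P A al u^-1 (Chit a * eta / u) (2 / (u ^+ 2 / n)) mu ->
  [/\ forall q w, `|D q w| <= 8 / (a ^+ 5 * n),
      forall q, \sum_w mu w * - D q w <= Cdrift a * eta / n &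
      forall q, two_sided q -> \sum_w mu w * D q w <= Cdrift a * eta / n].
Proof.
move=> IT a01 n0 g_eta hu hN hmu; have /andP[a0 a1] := a01.
have [mu0 mu1 _ _ _ _] := hmu.
have an0 : 0 < a * n by apply: mulr_gt0.
have n1 : 1 <= n by rewrite ler1n; rewrite ltr0n in n0.
have u_ge : a * n <= u by lra.
have N_ge : a * n <= N by lra.
have u0 : 0 < u by apply: lt_le_trans u_ge.
have N0 : 0 < N by apply: lt_le_trans N_ge.
pose g := n^-1; pose ia := a^-1.
have g0 : 0 < g by rewrite invr_gt0.
have eta0 : 0 < eta by apply: lt_le_trans g_eta.
have C1_ge0 : 0 <= Chit a.
  by have := Cperm_ge2 a0; rewrite /Chit; lra.
have err0 : 0 <= Chit a * eta / u.
  by rewrite divr_ge0 ?mulr_ge0 ?(ltW eta0) ?(ltW u0).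
have d0 : 0 < u ^+ 2 / n by rewrite divr_gt0 ?exprn_gt0.
have dmax0 : 0 <= 2 / (u ^+ 2 / n) by rewrite divr_ge0 ?(ltW d0).
have ia0 : 0 < ia by rewrite invr_gt0.
have ia1 : 1 <= ia by rewrite invf_ge1.
have ia2 : ia <= ia ^+ 2 by rewrite expr2 ler_peMr ?(ltW ia0).
have uV : u^-1 <= ia * g by rewrite /ia /g -invfM lef_pV2.
have NV : N^-1 <= ia * g by rewrite /ia /g -invfM lef_pV2.
have z_gt0 (q : var I T) : 0 < traj n u N q.
  apply: lt_le_trans (traj_lb q a01 n0 u_ge N_ge).
  by rewrite mulr_gt0 ?exprn_gt0.
pose z (q : var I T) := traj n u N q.
pose z' (q : var I T) := traj n (u - 1) (N - 1) q.
pose Z q := survivors A al q; pose p q := (z q - z' q) / z q.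
pose K q (w : I * {perm T}) := Z q - survivors (w.1 |: A) (upd P al w) q.
have a4n0 : 0 < a ^+ 4 * n by rewrite mulr_gt0 ?exprn_gt0.
have z'_ge q : a ^+ 4 * n <= z' q by apply: traj_lb.
have z'0 q : 0 < z' q by apply: lt_le_trans (z'_ge q).
have Z0 q : 0 <= Z q by apply: survivors_ge0.
have Zn q : Z q <= n by apply: survivors_le.
have DE q w : D q w = (Z q * p q - K q w) / z' q.
  rewrite /D /ratio -/u -/N -/(z q) -/(z' q) -/(Z q) /p /K; field.
  by rewrite (gt_eqF (z'0 q)) (gt_eqF (z_gt0 q)).
have div_le q x y : x <= y -> 0 <= y -> x / z' q <= y / (a ^+ 4 * n).
  move=> xy y0; apply: (@le_trans _ _ (y / z' q)).
    by rewrite ler_pM2r ?invr_gt0.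
  by rewrite ler_wpM2l // lef_pV2 ?posrE.
have prate (q : var I T) := traj_rate q a01 n1 hu hN.
have drift q := survivors_drift P_compat q hmu err0 dmax0.
have sumD q : \sum_w mu w * D q w = (Z q * p q - \sum_w mu w * K q w) / z' q.
  under eq_bigr do rewrite DE mulrA mulrBr.
  by rewrite -mulr_suml sumrB -mulr_suml mu1 mul1r.
pose Y := (4 * Chit a + 6) * eta * ia ^+ 2.
have YE : Cdrift a * eta / n = Y / (a ^+ 4 * n).
  by rewrite /Cdrift /Y /ia; field; rewrite !gt_eqF.
have Ysplit : Y = 4 * Chit a * eta * ia ^+ 2 + 6 * (ia ^+ 2 * eta).
  by rewrite /Y; ring.
have Y1 : 0 <= 4 * Chit a * eta * ia ^+ 2.
  by rewrite !mulr_ge0 ?sqr_ge0 ?(ltW ia0) ?(ltW eta0).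
have Y2 : 0 <= ia ^+ 2 * eta by rewrite mulr_ge0 ?sqr_ge0 ?(ltW ia0) ?(ltW eta0).
have Y0 : 0 <= Y by rewrite Ysplit addr_ge0 // mulr_ge0.
(* Absorbs the discretisation errors, of relative order 1 / n, into [eta]. *)
have Y3 : ia ^+ 2 * g <= ia ^+ 2 * eta by rewrite ler_wpM2l ?sqr_ge0.
have Zerr q : Z q * (4 * (Chit a * eta / u)) <= 4 * Chit a * eta * ia ^+ 2.
  have -> : 4 * Chit a * eta * ia ^+ 2 = n * (4 * (Chit a * eta * (ia ^+ 2 * g))).
    by rewrite /g; field; rewrite gt_eqF.
  rewrite ler_pM ?mulr_ge0 ?(ltW eta0) ?invr_ge0 ?(ltW u0) //.
  rewrite ler_pM2l // ler_wpM2l ?mulr_ge0 ?(ltW eta0) //.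
  by apply: le_trans uV _; rewrite ler_pM2r.
split=> [q w|q|q tq].
- have [p0 pr _ r4] := prate q; rewrite -/(z q) -/(z' q) -/(p q) in p0 pr.
  have /andP[K0 K4] : 0 <= K q w <= 4 := survivors_drop R P_compat A al w q.
  rewrite DE normrM normfV (gtr0_norm (z'0 q)).
  have -> : 8 / (a ^+ 5 * n) = 8 * ia / (a ^+ 4 * n).
    by rewrite /ia; field; rewrite !gt_eqF.
  apply: div_le; last by rewrite mulr_ge0 ?(ltW ia0).
  have Zp : Z q * p q <= n * (4 / (a * n)).
    by apply: ler_pM => //; apply: le_trans r4.
  have Zp0 : 0 <= Z q * p q by rewrite mulr_ge0.
  rewrite (_ : n * _ = 4 * ia) in Zp; last by rewrite /ia; field; rewrite !gt_eqF.
  by rewrite ler_norml; apply/andP; split; lra.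
- under eq_bigr do rewrite mulrN.
  rewrite sumrN sumD -mulNr YE; apply: div_le => //; rewrite opprB lerBlDr.
  have [Kup _] := drift q; apply: le_trans Kup _.
  have [_ _ rp _] := prate q; rewrite -/(z q) -/(z' q) -/(p q) in rp.
  rewrite -/(Z q) Ysplit; move: (rate _ _ _) rp => r rp.
  have h1 : Z q * (r - p q) <= 6 * (ia ^+ 2 * g).
    have -> : 6 * (ia ^+ 2 * g) = n * (6 / (a * n) ^+ 2).
      by rewrite /ia /g; field; rewrite !gt_eqF.
    apply: (@le_trans _ _ (Z q * (6 / (a * n) ^+ 2))); first by rewrite ler_wpM2l.
    by rewrite ler_wpM2r // divr_ge0 ?sqr_ge0.
  by have := Zerr q; lra.
rewrite sumD YE; apply: div_le => //; rewrite lerBlDr.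
have [_ pr _ _] := prate q; rewrite -/(z q) -/(z' q) -/(p q) in pr.
have [_ /(_ tq) Klo] := drift q; rewrite -/(Z q) -/(remaining A) -/N in Klo.
have h1 := ler_wpM2l (Z0 q) pr.
have h5 : 2 / (u ^+ 2 / n) <= 2 * (ia ^+ 2 * g).
  have -> : 2 / (u ^+ 2 / n) = 2 * (n * u^-1 ^+ 2).
    by field; rewrite !gt_eqF.
  have -> : 2 * (ia ^+ 2 * g) = 2 * (n * (ia * g) ^+ 2).
    by rewrite /g; field; rewrite !gt_eqF.
  rewrite ler_pM2l // ler_pM2l // lerXn2r ?nnegrE ?invr_ge0 ?(ltW u0) //.
  by rewrite mulr_ge0 ?(ltW g0) ?(ltW ia0).
have h6 : N^-1 <= ia ^+ 2 * g.
  by apply: le_trans NV _; rewrite ler_pM2r.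
have h7 := Zerr q.
apply: (@le_trans _ _ (Y + (Z q * (rate u^-1 N^-1 q
    - 4 * (Chit a * eta / u)) - (2 / (u ^+ 2 / n) + N^-1)))).
  by rewrite Ysplit; lra.
by rewrite lerD2l; apply: Klo.
Qed.

(** [lam] makes lam B = gam / 2 for the bound B = 8 / (a^5 n) on the jumps. The quadratic cost 2 lam
    B^2 = gam B is then at most 8 eta / (a^6 n), the excess of [Cgrow] over [Cdrift]. *)
Lemma potential_step (a gam eta : R) A al
    (lam := gam * a ^+ 5 * n / 16) (eta' := eta * (1 + Cgrow a / n)) :
  (#|I| <= #|T|)%N -> 0 < a <= 1 -> a * n <= unused A - 1 ->
  a * n <= remaining A - 1 -> n^-1 <= gam -> gam <= eta -> gam <= 1 -> 0 < n ->
  Cperm a * eta <= 1 -> potential lam eta A al < 1 ->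
  exists w : I * {perm T}, [/\ w.1 \notin A,
    forall c, edge P al w.1 c (w.2 c) &
    potential lam eta' (w.1 |: A) (upd P al w) <= potential lam eta A al].
Proof.
move=> IT a01 hu hN gam_n gam_eta gam1 n0 Ceta pot1; have /andP[a0 a1] := a01.
have gam0 : 0 < gam by apply: lt_le_trans gam_n; rewrite invr_gt0.
have eta0 : 0 < eta by apply: lt_le_trans gam_eta.
have g_eta : n^-1 <= eta by apply: le_trans gam_eta.
have lam0 : 0 < lam by rewrite divr_gt0 // !mulr_gt0 ?exprn_gt0.
have [|||mu hmu] := @random_choice lam a eta A al a01 n0 _ _ lam0 eta0 Ceta.
- by apply: le_trans hu _; rewrite gerBl.
- by apply: le_trans hN _; rewrite gerBl.
- exact: pot1.
have [mu0 mu1 mu_sup _ _ _] := hmu.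
pose u := unused A; pose N := remaining A.
pose D (q : var I T) (w : I * {perm T}) :=
  survivors (w.1 |: A) (upd P al w) q / traj n (u - 1) (N - 1) q - ratio A al q.
pose B := 8 / (a ^+ 5 * n); pose A0 := Cdrift a * eta / n.
have [DB lowD upD] : [/\ forall q w, `|D q w| <= B,
    forall q, \sum_w mu w * - D q w <= A0 &
    forall q, two_sided q -> \sum_w mu w * D q w <= A0].
  exact: ratio_drift.
have [delta deltaE] : exists delta, delta = eta * (Cgrow a / n) by eexists.
have eta'E : eta' = eta + delta by rewrite deltaE /eta' mulrDr mulr1.
have lamB : lam * B = gam / 2.
  by rewrite /lam /B; field; rewrite !gt_eqF.
have lamB1 : lam * B <= 1 / 2 by rewrite lamB ler_pM2r // invr_gt0.
have A0d : A0 + 2 * lam * B ^+ 2 <= delta.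
  have -> : 2 * lam * B ^+ 2 = 2 * (lam * B) * B by ring.
  rewrite lamB deltaE.
  have -> : eta * (Cgrow a / n) = A0 + 8 * eta / (a ^+ 6 * n).
    by rewrite /A0 /Cgrow /Cdrift; field; rewrite !gt_eqF.
  have -> : 2 * (gam / 2) * B = 8 * (gam * a) / (a ^+ 6 * n).
    by rewrite /B; field; rewrite !gt_eqF.
  rewrite lerD2l ler_pM2r ?invr_gt0 ?mulr_gt0 ?exprn_gt0 // ler_pM2l //.
  by rewrite (le_trans _ gam_eta) // ler_piMr // ltW.
pose F w := \sum_q expR (lam * (1 - (ratio A al q + D q w) - eta')) +
  \sum_(q | two_sided q) expR (lam * (ratio A al q + D q w - 1 - eta')).
have FE : \sum_w mu w * F w <= potential lam eta A al.
  rewrite /F; under eq_bigr do rewrite mulrDr 2!mulr_sumr.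
  rewrite big_split /= lerD //.
    rewrite exchange_big /=; apply: ler_sum => q _.
    have := @exp_step R _ mu (fun w => - D q w) lam B A0 (1 - ratio A al q) eta
      delta mu0 mu1 (ltW lam0) _ lamB1 (lowD q) A0d.
    rewrite -eta'E => h; apply: le_trans (h _); last by move=> w; rewrite normrN.
    apply: ler_sum => w _; rewrite ler_wpM2l // le_eqVlt; apply/orP; left.
    by apply/eqP; congr (expR (lam * _)); ring.
  rewrite exchange_big /=; apply: ler_sum => q tq.
  have := @exp_step R _ mu (D q) lam B A0 (ratio A al q - 1) eta
    delta mu0 mu1 (ltW lam0) (DB q) lamB1 (upD q tq) A0d.
  rewrite -eta'E => h; apply: le_trans h.
  apply: ler_sum => w _; rewrite ler_wpM2l // le_eqVlt; apply/orP; left.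
  by apply/eqP; congr (expR (lam * _)); ring.
have [w muw Fw] := average_le mu0 mu1 FE.
have [wA wE] := mu_sup w muw.
exists w; split=> //; apply: le_trans Fw.
have uE : unused (w.1 |: A) = u - 1.
  by rewrite /u /unused cardsU1 wA add1n -natr1; ring.
have NE : remaining (w.1 |: A) = N - 1.
  rewrite /N /remaining (cardsD1 w.1 (~: A)) in_setC wA add1n -natr1.
  have -> : ~: (w.1 |: A) = (~: A) :\ w.1 by apply/setP => i; rewrite !inE negb_or.
  by rewrite addrK.
have ratioE q : ratio (w.1 |: A) (upd P al w) q = ratio A al q + D q w.
  by rewrite /D addrC subrK /ratio uE NE.
rewrite /potential /F le_eqVlt; apply/orP; left; apply/eqP.
by congr (_ + _); apply: eq_bigr => q _; rewrite ratioE.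
Qed.

End Step.

(** * Colouring all rows *)

Section Realize.
Variables (I T : finType) (P : bool -> I -> {perm T}).
Implicit Types (A : {set I}) (al : bool -> T -> T -> bool) (L : I -> {perm T}).
Implicit Types w : I * {perm T}.

(** For [b = false] this is the column condition on L, for [b = true] it yields orthogonality to J;
    the row condition is built into permutations. *)
Definition proper A L := forall b i i' v, i \in A -> i' \in A ->
  L i (slot P b i v) = L i' (slot P b i' v) -> i = i'.

Definition realizes A al := exists2 L, proper A L &
  forall b v k, al b v k = [forall i in A, L i (slot P b i v) != k].

Lemma realizes0 : realizes set0 (fun _ _ _ => true).
Proof.
exists (fun=> 1%g) => [b i i' v|b v k]; first by rewrite inE.
by apply/esym/forall_inP => i; rewrite inE.
Qed.

Lemma realizes_step A al w : realizes A al -> w.1 \notin A ->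
  (forall c, edge P al w.1 c (w.2 c)) -> realizes (w.1 |: A) (upd P al w).
Proof.
move=> [L properL alE] wA wE.
have neq b i v : i \in A -> w.2 (slot P b w.1 v) != L i (slot P b i v).
  move=> iA; have := wE (slot P b w.1 v); rewrite edge_slot alE => /andP[+ _].
  by move=> /forall_inP/(_ i iA); rewrite eq_sym.
exists (fun i => if i == w.1 then w.2 else L i) => [b i i' v|b v k].
  rewrite !in_setU1; have [-> _|iw] := eqVneq i w.1.
    have [//|i'w /= i'A e] := eqVneq i' w.1.
    by have := neq b i' v i'A; rewrite e eqxx.
  have [-> /= iA _ e|i'w /= iA i'A] := eqVneq i' w.1; last exact: properL.
  by have := neq b i v iA; rewrite e eqxx.
rewrite /upd alE /hit; apply/andP/forall_inP => [[/forall_inP h hw] i|h].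
  by rewrite in_setU1; have [->|_ /=] := eqVneq i w.1; [|apply: h].
split; last by have := h w.1; rewrite setU11 eqxx => /(_ isT).
apply/forall_inP => i iA; have := h i; rewrite in_setU1 iA orbT.
have [iw|_ /(_ isT)//] := eqVneq i w.1; first by rewrite -iw iA in wA.
Qed.

End Realize.

(** * The final segment with arbitrary matchings *)

Section Greedy.
Variables (R : realFieldType) (I T : finType) (P : bool -> I -> {perm T}).
Hypothesis P_compat : compat P.
Local Notation survivors := (@survivors R I T P).

(** The hypotheses reserve a slack of 4 per remaining row. A step costs each count at most 4 and
    removes one row, so they persist whichever matching is taken. *)
Lemma greedy_finish (d kap eta : R) A al (n := #|T|%:R : R) :
  0 < kap -> 0 < d <= n -> 0 <= eta -> (2 + 8 / kap) * eta <= 1 ->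
  realizes P A al ->
  (forall i c, i \notin A ->
    `|survivors A al (inl (inl (inl (i, c)))) - d| + 4 * #|~: A|%:R <= eta * d) ->
  (forall i k, i \notin A ->
    `|survivors A al (inl (inl (inr (i, k)))) - d| + 4 * #|~: A|%:R <= eta * d) ->
  (forall i c c', i \notin A ->
    kap * n + 4 * #|~: A|%:R <= survivors A al (inr (i, c, c'))) ->
  exists al', realizes P setT al'.
Proof.
move=> kap0 dn eta0 Ceta.
have [s sE] := ubnP #|~: A|; elim: s A al sE => // s IHs A al sA rA hX hY hW.
have [A0|[i]] := set_0Vmem (~: A).
  by exists al; rewrite -[setT]setC0 -A0 setCK.
rewrite inE => iA; have N_ge0 : 0 <= #|~: A|%:R :> R by apply: ler0n.
have [|||c [c0 c1 c_sub _]] := random_perm (G := edge P al i) kap0 dn eta0 Ceta.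
- by move=> c; have := hX i c iA; rewrite /survivors; lra.
- by move=> k; have := hY i k iA; rewrite /survivors; lra.
- by move=> c c'; have := hW i c c' iA; rewrite /survivors; lra.
(* Averaging the zero function just extracts a matching of positive weight. *)
have [|s0 s0_gt0 _] := @average_le _ _ c (fun=> 0) 0 c0 c1.
  by rewrite big1 // => s0 _; rewrite mulr0.
pose w := (i, s0).
have NE : #|~: A|%:R = #|~: (i |: A)|%:R + 1 :> R.
  rewrite (cardsD1 i (~: A)) in_setC iA add1n -natr1; congr (_%:R + 1).
  by apply: eq_card => i'; rewrite !inE negb_or.
have drop q := survivors_drop R P_compat A al w q.
have dist x x' : 0 <= x - x' <= 4 -> `|x - d| + 4 * #|~: A|%:R <= eta * d ->
    `|x' - d| + 4 * #|~: (i |: A)|%:R <= eta * d.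
  move=> /andP[x1 x2]; rewrite NE => h.
  have : `|x' - d| <= `|x - d| + `|x' - x|.
    by rewrite (_ : x' - d = x - d + (x' - x)) ?ler_normD //; ring.
  by rewrite (distrC x' x) (ger0_norm x1); lra.
apply: (IHs (w.1 |: A) (upd P al w)).
- rewrite -ltnS; apply: leq_trans sA; rewrite ltnS; apply: proper_card.
  by rewrite properC properE subsetUr subUset sub1set (negPf iA).
- by apply: realizes_step => // j; apply: c_sub.
- move=> i' c' i'A; apply: dist (drop _) (hX i' c' _).
  by apply: contra i'A; rewrite in_setU1 => ->; rewrite orbT.
- move=> i' k i'A; apply: dist (drop _) (hY i' k _).
  by apply: contra i'A; rewrite in_setU1 => ->; rewrite orbT.
- move=> i' c' c'' i'A; have /andP[_] := drop (inr (i', c', c'')).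
  have {}i'A : i' \notin A.
    by apply: contra i'A; rewrite in_setU1 => ->; rewrite orbT.
  by have := hW i' c' c'' i'A; rewrite NE; lra.
Qed.

End Greedy.

(** * The random phase *)

Section Random.
Variables (R : realType) (I T : finType) (P : bool -> I -> {perm T}).
Hypothesis P_compat : compat P.
Local Notation survivors := (@survivors R I T P).
Let n : R := #|T|%:R.
Let m : R := #|I|%:R.
Hypothesis I_le_T : (#|I| <= #|T|)%N.
Variables (a gam : R).
Hypotheses (a0 : 0 < a) (a1 : a <= 1) (gam0 : 0 < gam) (gam1 : gam <= 1).
Hypothesis gam_C : Cperm a * (gam * expR (Cgrow a)) <= 1.
Hypothesis gam_n : n^-1 <= gam.
Hypothesis I0 : (0 < #|I|)%N.
Hypothesis n_big : 10 * (64 / (gam ^+ 2 * a ^+ 5)) ^+ 4 <= n.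

Let lam := gam * a ^+ 5 * n / 16.
Let eta t := gam * (1 + Cgrow a / n) ^+ t.

Let n0 : 0 < n.
Proof. by rewrite ltr0n (leq_trans I0). Qed.

Let n1 : 1 <= n.
Proof. by rewrite ler1n (leq_trans I0). Qed.

(** Over at most n steps the tolerance grows only by a constant factor, as (1 + C / n)^n <=
    exp(C). *)
Lemma eta_bounds t : (t <= #|T|)%N -> gam <= eta t <= gam * expR (Cgrow a).
Proof.
move=> tT; have C0 : 0 <= Cgrow a / n by rewrite divr_ge0 ?Cgrow_ge0 // ltW.
have base : 1 <= 1 + Cgrow a / n by rewrite lerDl.
rewrite /eta ler_peMr ?exprn_ege1 ?(ltW gam0) //= ler_pM2l //.
apply: (@le_trans _ _ ((1 + Cgrow a / n) ^+ #|T|)); first exact: ler_weXn2l.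
have -> : expR (Cgrow a) = expR (Cgrow a / n) ^+ #|T|.
  by rewrite -expRM_natr -/n divfK // gt_eqF.
by rewrite lerXn2r ?nnegrE ?expR_ge0 ?expR_ge1Dx // (le_trans _ base).
Qed.

Lemma ratio0 q : ratio R P set0 (fun _ _ _ => true) q = 1.
Proof.
have m0 : 0 < m by rewrite ltr0n.
have one (O : finType) : \sum_(o : O) 1 = #|O|%:R :> R.
  by rewrite sumr_const.
rewrite /ratio /unused /remaining cards0 setC0 cardsT subr0 -/n -/m.
case: q => [[[[i c]|[i k]]|[[b v] k]]|[[i c] c']] /=.
- by rewrite one -/n; field; rewrite gt_eqF.
- by rewrite one -/n; field; rewrite gt_eqF.
- under eq_bigr do rewrite in_set0.
  by rewrite one -/m; field; rewrite !gt_eqF.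
- by rewrite one -/n; field; rewrite gt_eqF.
Qed.

Lemma card_var : #|var I T|%:R <= 5 * n ^+ 3.
Proof.
have mn : m <= n by rewrite ler_nat.
rewrite !(card_sum, card_prod, card_bool) !natrD !natrM -/n -/m.
have h2 : n * n <= n * n * n by rewrite ler_peMr // mulr_ge0 // ltW.
have h1 : m * n <= n * n by rewrite ler_pM2r.
have h3 : m * n * n <= n * n * n by rewrite ler_pM2r.
by rewrite (_ : n ^+ 3 = n * n * n); [lra|ring].
Qed.

(** All ratios start at exactly 1, so each of the at most 10 n^3 summands is exp(- c n). Since exp(c
    n) >= (1 + c n / 4)^4 > (c n / 4)^4, this is where [n_big] is needed. *)
Lemma potential0 : potential P lam gam set0 (fun _ _ _ => true) < 1.
Proof.
pose c := gam ^+ 2 * a ^+ 5 / 16.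
have c0 : 0 < c by rewrite !mulr_gt0 ?exprn_gt0 ?invr_gt0.
have lamE : lam * gam = c * n by rewrite /lam /c; field.
have -> : potential P lam gam set0 (fun _ _ _ => true) =
    (#|var I T|%:R + #|two_sided (I := I) (T := T)|%:R) * expR (- (c * n)).
  rewrite /potential.
  under eq_bigr do rewrite ratio0 subrr sub0r mulrN lamE.
  under [X in _ + X]eq_bigr do rewrite ratio0 subrr sub0r mulrN lamE.
  by rewrite !sumr_const mulrDl !mulr_natl.
apply: (@le_lt_trans _ _ (10 * n ^+ 3 * expR (- (c * n)))).
  rewrite ler_wpM2r ?expR_ge0 //.
  have h : #|two_sided (I := I) (T := T)|%:R <= #|var I T|%:R :> R.
    by rewrite ler_nat max_card.
  by have := card_var; lra.
rewrite expRN ltr_pdivrMr ?expR_gt0 // mul1r.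
have -> : expR (c * n) = expR (c * n / 4) ^+ 4.
  by rewrite -expRM_natr; congr expR; field.
have cn0 : 0 < c * n / 4 by rewrite !mulr_gt0 ?invr_gt0.
apply: (@lt_le_trans _ _ ((1 + c * n / 4) ^+ 4)); last first.
  by rewrite lerXn2r ?nnegrE ?expR_ge0 ?expR_ge1Dx //; lra.
apply: (@le_lt_trans _ _ ((c * n / 4) ^+ 4)); last first.
  by rewrite ltrXn2r ?nnegrE //; lra.
have -> : (c * n / 4) ^+ 4 = n ^+ 3 * ((c / 4) ^+ 4 * n) by field.
rewrite mulrC ler_pM2l ?exprn_gt0 //.
have c4 : 0 < (c / 4) ^+ 4 by rewrite exprn_gt0 // divr_gt0.
rewrite mulrC -ler_pdivrMr // -exprVn.
apply: le_trans n_big; rewrite ler_pM2l // le_eqVlt; apply/orP; left.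
by apply/eqP; congr (_ ^+ 4); rewrite /c; field; rewrite !gt_eqF.
Qed.

Lemma random_phase t :
  (t <= #|I|)%N -> ((0 < t)%N -> t%:R + a * n <= m) ->
  exists A al, [/\ realizes P A al, #|A| = t & potential P lam (eta t) A al < 1].
Proof.
have mn : m <= n by rewrite ler_nat.
elim: t => [_ _|t IHt tI /(_ isT) tm].
  exists set0, (fun _ _ _ => true); split; first exact: realizes0.
    exact: cards0.
  by rewrite /eta expr0 mulr1; apply: potential0.
rewrite -natr1 in tm.
have [||A [al [rA cA potA]]] := IHt; [exact: ltnW|by move=> _; lra|].
have /andP[eta1 eta2] : gam <= eta t <= gam * expR (Cgrow a).
  by apply: eta_bounds; apply: leq_trans I_le_T; apply: ltnW.
have C_ge2 := Cperm_ge2 a0.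
have [||||||||||w [wA wE potw]] :=
    @potential_step R I T P P_compat a gam (eta t) A al.
- exact: I_le_T.
- by rewrite a0.
- by rewrite /unused cA; lra.
- have -> : remaining R A = m - t%:R.
    by rewrite /remaining /m -(cardsC A) natrD cA; ring.
  by lra.
- exact: gam_n.
- exact: eta1.
- exact: gam1.
- exact: n0.
- apply: le_trans gam_C; rewrite ler_wpM2l //; lra.
- exact: potA.
exists (w.1 |: A), (upd P al w); split.
- exact: realizes_step.
- by rewrite cardsU1 wA cA.
- by rewrite /eta exprSr mulrA; apply: le_lt_trans potA.
Qed.

End Random.

(** The tolerance eta2 d of the final segment covers the random error, at most eta2 d / 4, and the
    reserve 4 N, also at most eta2 d / 4. Common degrees exceed e^4 n / 2, and the reserve leaves
    e^4 n / 4. *)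
Lemma finish_phase (R : realType) (I T : finType) (P : bool -> I -> {perm T})
    (lam eta e eta2 : R) A al (n := #|T|%:R : R) :
  compat P -> 0 < n -> 0 < e <= 1 -> 0 < eta2 <= 1 / 2 ->
  (2 + 8 / (e ^+ 4 / 4)) * eta2 <= 1 -> 4 * eta <= eta2 -> 0 < lam ->
  e * n <= unused R T A -> 4 * remaining R A <= eta2 / 4 * (e ^+ 4 * n) ->
  realizes P A al -> potential P lam eta A al < 1 ->
  exists al', realizes P setT al'.
Proof.
move=> P_compat n0 /andP[e0 e1] /andP[eta2_0 eta2_1] Ceta eta4 lam0 u_ge N4 rA pot.
have near q := potential_lt1 q lam0 pot.
have ratioE q : ratio R P A al q =
  survivors R P A al q / traj n (unused R T A) (remaining R A) q by [].
have u_le : unused R T A <= n by rewrite gerBl ler0n.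
move: (unused R T A) u_ge u_le ratioE => u u_ge u_le ratioE.
have en0 : 0 < e * n by apply: mulr_gt0.
have u0 : 0 < u by apply: lt_le_trans u_ge.
have e4_0 : 0 < e ^+ 4 by rewrite exprn_gt0.
have [d dE] : exists d, d = u ^+ 2 / n by exists (u ^+ 2 / n).
have d0 : 0 < d by rewrite dE divr_gt0 ?exprn_gt0.
have d_ge : e ^+ 2 * n <= d.
  rewrite dE ler_pdivlMr // -mulrA -expr2 -exprMn.
  by rewrite lerXn2r ?nnegrE ?(ltW en0) ?(ltW u0).
have d_le : d <= n.
  by rewrite dE ler_pdivrMr // expr2 ler_pM ?(ltW u0).
have N4d : 4 * remaining R A <= eta2 / 4 * d.
  apply: le_trans N4 _; rewrite ler_wpM2l //; first by rewrite divr_ge0 // ltW.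
  by apply: le_trans d_ge; rewrite ler_pM2r // ler_wiXn2l // ltW.
have two q : two_sided q -> traj n u (remaining R A) q = d ->
    `|survivors R P A al q - d| + 4 * remaining R A <= eta2 * d.
  move=> tq zE; have [h1 /(_ tq) h2] := near q; move: h1 h2.
  rewrite ratioE zE ltr_pdivlMr // ltr_pdivrMr // => h1 h2.
  have h3 : `|survivors R P A al q - d| <= eta * d.
    by clear - h1 h2; rewrite ler_distl; apply/andP; split; lra.
  have h4 : 4 * eta * d <= eta2 * d by rewrite ler_pM2r.
  have h5 : 0 <= eta2 * d by rewrite mulr_ge0 ?ltW.
  by clear - h3 h4 h5 N4d; lra.
apply: (greedy_finish P_compat (d := d) (kap := e ^+ 4 / 4) (eta := eta2)
  _ _ _ Ceta rA).
- by rewrite divr_gt0.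
- by rewrite d0.
- exact: ltW.
- by move=> i c _; apply: two => //=; rewrite dE.
- by move=> i k _; apply: two => //=; rewrite dE.
move=> i c c' _; have [h _] := near (inr (i, c, c')); move: h.
have z_ge : e ^+ 4 * n <= u ^+ 4 / n ^+ 3.
  rewrite ler_pdivlMr ?exprn_gt0 // -mulrA -exprS -exprMn.
  by rewrite lerXn2r ?nnegrE ?(ltW en0) ?(ltW u0).
rewrite ratioE [traj _ _ _ _]/= ltr_pdivlMr; last by rewrite divr_gt0 ?exprn_gt0.
rewrite -/n -/(remaining R A).
move: (survivors _ _ _ _ _) (u ^+ 4 / n ^+ 3) z_ge => x z z_ge h.
have h0 : 0 < e ^+ 4 * n by rewrite mulr_gt0.
have z0 : 0 < z by apply: lt_le_trans z_ge.
have h1 : 1 / 2 * z <= (1 - eta) * z.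
  by rewrite ler_pM2r //; clear - eta4 eta2_1; lra.
have h2 : eta2 / 4 * (e ^+ 4 * n) <= 1 / 4 * (e ^+ 4 * n).
  by rewrite ler_pM2r //; clear - eta2_1; lra.
have -> : e ^+ 4 / 4 * n = 1 / 4 * (e ^+ 4 * n) by field.
by clear - h h1 h2 z_ge N4; lra.
Qed.

(** Order of choice: [eta2] from [e] for the final segment, then [a] so that 2 a n last rows fit
    into its reserve, then [gam] small against the growth of the tolerance, which depends on [a]. *)
Lemma parameters (R : realType) (e : R) : 0 < e <= 1 -> exists eta2 a gam : R,
  [/\ 0 < eta2 <= 1 / 2, (2 + 8 / (e ^+ 4 / 4)) * eta2 <= 1,
      0 < a <= 1 & 32 * a = eta2 * e ^+ 4] /\
  [/\ 0 < gam, gam <= 1, Cperm a * (gam * expR (Cgrow a)) <= 1 &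
      4 * (gam * expR (Cgrow a)) <= eta2].
Proof.
move=> /andP[e0 e1].
have e4_0 : 0 < e ^+ 4 by rewrite exprn_gt0.
have e4_1 : e ^+ 4 <= 1 by rewrite exprn_ile1 // ltW.
pose K := 2 + 8 / (e ^+ 4 / 4).
have K2 : 2 <= K by rewrite lerDl !divr_ge0 // ltW.
have K0 : 0 < K by apply: lt_le_trans K2.
have eta2_0 : 0 < K^-1 by rewrite invr_gt0.
have eta2_1 : K^-1 <= 1 / 2 by rewrite div1r lef_pV2 ?posrE.
have a0 : 0 < K^-1 * e ^+ 4 / 32 by rewrite divr_gt0 // mulr_gt0.
have a1 : K^-1 * e ^+ 4 / 32 <= 1.
  have : K^-1 * e ^+ 4 <= 1 * 1.
    by rewrite ler_pM ?(ltW eta2_0) ?(ltW e4_0) //; lra.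
  by lra.
exists K^-1, (K^-1 * e ^+ 4 / 32).
have aE : 32 * (K^-1 * e ^+ 4 / 32) = K^-1 * e ^+ 4 by field; rewrite gt_eqF.
have KV : K * K^-1 = 1 by rewrite divff ?gt_eqF.
rewrite -/K KV; move: (_ / 32) a0 a1 aE => a a0 a1 aE.
have C2 := Cperm_ge2 a0; have Cg0 := Cgrow_ge0 a0.
move: (expR _) (expR_gt0 (Cgrow a)) (expR_ge1Dx (Cgrow a)) => E E0 E1.
have EV1 : E^-1 <= 1 by rewrite invf_le1 //; lra.
move: (Cperm a) C2 => C C2; have C0 : 0 < C by lra.
have eta1_0 : 0 < K^-1 / (2 * C) by rewrite divr_gt0 // mulr_gt0.
have eta1_4 : 4 * (K^-1 / (2 * C)) <= K^-1.
  by rewrite mulrA ler_pdivrMr ?mulr_gt0 // mulrC ler_pM2l //; lra.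
have CE : C * (K^-1 / (2 * C)) = K^-1 / 2 by field; rewrite !gt_eqF.
exists (K^-1 / (2 * C) / E); split; first by split; rewrite ?a0 ?eta2_0.
rewrite divfK ?gt_eqF // CE; split=> //; try lra.
  by rewrite divr_gt0.
have : K^-1 / (2 * C) / E <= K^-1 / (2 * C) * 1 by rewrite ler_pM2l.
by lra.
Qed.

(** * Joining the phases and reading off the companion *)

Lemma realization_exists (R : realType) (eps : R) : 0 < eps -> exists n0 : nat,
  forall (I T : finType) (P : bool -> I -> {perm T}), compat P ->
  (n0 <= #|T|)%N -> #|I|%:R <= #|T|%:R * (1 - eps) ->
  exists al, realizes P setT al.
Proof.
move=> eps0.
have [e /andP[e0 e1] e_eps] : exists2 e : R, 0 < e <= 1 & e <= eps.
  exists (Num.min eps 1); last by rewrite ge_min lexx.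
  by rewrite lt_min eps0 ltr01 ge_min lexx orbT.
have [|eta2 [a [gam [[eta2_01 Ceta /andP[a0 a1] aE] [gam0 gam1 gam_C gam_4]]]]] :=
  parameters (e := e); first by rewrite e0.
have [big bigE] : exists big, big = 10 * (64 / (gam ^+ 2 * a ^+ 5)) ^+ 4.
  by eexists.
have big0 : 0 < big.
  by rewrite bigE mulr_gt0 // exprn_gt0 // divr_gt0 // mulr_gt0 ?exprn_gt0.
(* The three terms give 1 / n <= gam, the initial bound on the potential, and a n >= 1. *)
exists (Num.truncn (gam^-1 + big + a^-1)).+1 => I T P P_compat Tn mn.
have [n nE] : exists n : R, n = #|T|%:R by eexists.
have [m mE] : exists m : R, m = #|I|%:R by eexists.
rewrite -nE -mE in mn.
have nX : gam^-1 + big + a^-1 < n.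
  by apply: lt_le_trans (truncnS_gt _) _; rewrite nE ler_nat.
have gamV0 : 0 < gam^-1 by rewrite invr_gt0.
have aV0 : 0 < a^-1 by rewrite invr_gt0.
have n0 : 0 < n by clear - nX gamV0 aV0 big0; lra.
have men : m + e * n <= n.
  have : e * n <= eps * n by rewrite ler_pM2r.
  by clear - mn; lra.
have IT : (#|I| <= #|T|)%N.
  have en0 : 0 < e * n by apply: mulr_gt0.
  by rewrite -(ler_nat R) -nE -mE; clear - en0 men; lra.
have [I0|I0] := posnP #|I|.
  exists (fun _ _ _ => true); suff -> : [set: I] = set0 by apply: realizes0.
  by apply/eqP; rewrite -cards_eq0 cardsT I0.
have gam_n : n^-1 <= gam.
  rewrite -[gam]invrK lef_pV2 ?posrE //.
  by clear - nX gamV0 aV0 big0; lra.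
have an1 : 1 <= a * n.
  have <- : a * a^-1 = 1 by rewrite divff // gt_eqF.
  by rewrite ler_pM2l //; clear - nX gamV0 aV0 big0; lra.
(* The random phase stops once at most 2 a n rows remain. If t > 0, minimality leaves more than 2 a
   n - 1 >= a n rows; if there are few rows from the start, then t = 0. *)
have ex_t : exists t, (#|I| - t)%:R <= 2 * (a * n).
  by exists #|I|; rewrite subnn !mulr_ge0 // ltW.
have [t t_le t_min] := ex_minnP ex_t.
have tI : (t <= #|I|)%N.
  by apply: t_min; rewrite subnn !mulr_ge0 // ltW.
have tm : t%:R <= m by rewrite mE ler_nat.
rewrite natrB // -mE in t_le.
have n_big : 10 * (64 / (gam ^+ 2 * a ^+ 5)) ^+ 4 <= #|T|%:R.
  by rewrite -bigE -nE; clear - nX gamV0 aV0; lra.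
have t_an : (0 < t)%N -> t%:R + a * #|T|%:R <= #|I|%:R.
  move=> t_gt0; rewrite -nE -mE.
  have : 2 * (a * n) < (#|I| - t.-1)%:R.
    by rewrite ltNge; apply/negP => /t_min; rewrite -ltnS prednK // ltnn.
  have -> : (#|I| - t.-1)%:R = m - t%:R + 1 :> R.
    by rewrite -subSS prednK // subSn // -natr1 natrB // mE.
  by clear - an1; lra.
rewrite nE in gam_n.
have [A [al [rA cA pot]]] :=
  random_phase P_compat IT a0 a1 gam0 gam1 gam_C gam_n I0 n_big tI t_an.
have /andP[_ eta_le] := eta_bounds IT a0 gam0 I0 (leq_trans tI IT).
have NE : remaining R A = m - t%:R.
  by rewrite /remaining mE -(cardsC A) natrD cA addrC addKr.
apply: finish_phase P_compat _ _ eta2_01 Ceta _ _ _ _ rA pot.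
- by rewrite -nE.
- by rewrite e0.
- by clear - eta_le gam_4; lra.
- by rewrite divr_gt0 // -nE !mulr_gt0 // exprn_gt0.
- by rewrite /unused cA -nE; clear - men tm; lra.
rewrite NE -nE; clear - t_le aE.
have -> : eta2 / 4 * (e ^+ 4 * n) = 8 * (a * n).
  have -> : eta2 / 4 * (e ^+ 4 * n) = eta2 * e ^+ 4 / 4 * n by field.
  by rewrite -aE; field.
by lra.
Qed.

Theorem theorem1 (R : realType) (eps : R) (heps : 0 < eps) :
  exists n0 : nat, forall n m : nat, (n0 <= n)%N ->
    m%:Z = Num.floor (n%:R * (1 - eps)) ->
    forall (S : finType), #|S| = n ->
    forall J : 'I_m -> 'I_n -> S, latin_rectangle J ->
    exists L : 'I_m -> 'I_n -> S,
      latin_rectangle L /\ orthogonal_rectangles L J.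
Proof.
have [n0 hn0] := realization_exists heps.
exists n0 => n m n0n mE S Sn; subst n => J [J_row J_col].
have J_inj i : injective (J i).
  move=> j j' e; have /eqP/cards1P[j0 /setP E] := J_row i (J i j).
  move: (E j) (E j'); rewrite !inE -e eqxx => /esym/eqP -> /esym/eqP -> //.
have Jc_inj i i' j : J i j = J i' j -> i = i'.
  move=> e; apply: (card_le1_eqP (J_col j (J i j))); rewrite inE ?eqxx //.
  by rewrite e.
have Jr_inj i : injective (fun c => J i (enum_rank c)).
  by move=> c c' /J_inj /enum_rank_inj.
(* Columns are indexed by [S] itself through [enum_rank], so the cell-to-column map is the identity
   and the cell-to-symbol map is row [i] of J. *)
pose P (b : bool) i : {perm S} := if b then perm (@Jr_inj i) else 1%g.
have P_compat : compat P.
  by move=> i i' c c'; rewrite /P !perm1 => <-; rewrite !permE => /Jc_inj.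
have m_le : #|'I_m|%:R <= #|S|%:R * (1 - eps).
  rewrite card_ord; apply: le_trans (Num.Theory.floor_le _).
  by rewrite -mE.
have [al [L properL _]] := hn0 _ S P P_compat n0n m_le.
have L_col i i' v : L i v = L i' v -> i = i'.
  move=> e; apply: (properL false i i' v); rewrite ?inE //.
  by rewrite /slot /P invg1 !perm1.
have L_sym i i' c c' : J i (enum_rank c) = J i' (enum_rank c') ->
    L i c = L i' c' -> i = i'.
  move=> eJ eL; apply: (properL true i i' (J i (enum_rank c))); rewrite ?inE //.
  rewrite /slot /P -{1}[J i (enum_rank c)](permE (@Jr_inj i)) permK.
  by rewrite eJ -[J i' (enum_rank c')](permE (@Jr_inj i')) permK.
exists (fun i j => L i (enum_val j)); split; first split.
- move=> i s; apply/eqP/cards1P; exists (enum_rank ((L i)^-1 s)%g).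
  apply/setP => j; rewrite !inE; apply/eqP/eqP => [<-|->].
    by rewrite permK enum_valK.
  by rewrite enum_rankK permKV.
- move=> j s; apply/card_le1_eqP => i i'; rewrite !inE => /eqP <- /eqP.
  by move=> /L_col.
(* Two cells agreeing in both symbols lie in one row by [L_sym], and then coincide because a row of
   J is injective. *)
move=> s s'; apply/card_le1_eqP => -[i j] [i' j'].
rewrite !inE /= => /andP[/eqP Ls /eqP Js] /andP[/eqP Ls' /eqP Js'].
have ii' : i = i'.
  apply: (L_sym i i' (enum_val j) (enum_val j')); last by rewrite Ls.
  by rewrite !enum_valK Js.
subst i'; congr (_, _).
by apply: (J_inj i); rewrite Js.
Qed.
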